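(* There is an absolute constant $C$ such that for every finite field $\mathbb{F}_q$, every $m>0$ and every degree $d$ with $q>C\cdot d$ the following holds. Suppose a points table $f:\mathbb{F}_q^m\to\mathbb{F}_q$ and a degree-$d$ lines oracle $\ell\mapsto P_\ell$ satisfy $$\Pr_{\mathbf{a}\in\mathbb{F}_q^m,\ \ell\ni\mathbf{a}}[f(\mathbf{a})\neq P_\ell(\mathbf{a})]\le\delta$$ for some $0<\delta<0.01$. Then there is an $m$-variate polynomial $Q$ of total degree at most $d$ with $\Pr_{\mathbf{a}\in\mathbb{F}_q^m}[f(\mathbf{a})\ne Q(\mathbf{a})]\le 4\delta$.
   Context: An (affine) line in $\mathbb{F}_q^m$ is a set $\ell=\{\mathbf{a}+t\mathbf{u}:t\in\mathbb{F}_q\}$ with $\mathbf{u}\neq 0$; a degree-$d$ polynomial on $\ell$ is a function on $\ell$ given, under a parametrization, by a univariate polynomial of degree at most $d$ in $t$. A degree-$d$ lines oracle assigns to every line $\ell$ a degree-$d$ polynomial $P_\ell$ on $\ell$. In probabilities, $\mathbf{a}$ is uniform and $\ell\ni\mathbf{a}$ is a uniformly random line through $\mathbf{a}$. *)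

(* Defs.v *)
From HB Require Import structures.
From mathcomp Require Import all_boot all_order all_algebra all_field.
From mathcomp Require Import mpoly.
Set Implicit Arguments. Unset Strict Implicit. Unset Printing Implicit Defensive.
Import Order.TTheory GRing.Theory Num.Theory.
Local Open Scope ring_scope.

Definition line (F : finFieldType) (m : nat) (a u : 'rV[F]_m) : {set 'rV[F]_m} :=
  [set a + t *: u | t : F].

Definition is_line (F : finFieldType) (m : nat) (L : {set 'rV[F]_m}) : bool :=
  [exists a : 'rV[F]_m, exists u : 'rV[F]_m, (u != 0) && (L == line a u)].

(* A degree-d lines oracle: assigns to every line L a function P L on points
   which, on L and under some parametrization a + t u of L, is given by a
   univariate polynomial of degree at most d in t. Values off L are irrelevant. *)
Definition lines_oracle (F : finFieldType) (m d : nat)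
  (P : {set 'rV[F]_m} -> 'rV[F]_m -> F) : Prop :=
  forall L : {set 'rV[F]_m}, is_line L ->
    exists a u : 'rV[F]_m, exists p : {poly F},
      [/\ u != 0, L = line a u, (size p <= d.+1)%N &
          forall t : F, P L (a + t *: u) = p.[t]].

Definition lines_through (F : finFieldType) (m : nat) (a : 'rV[F]_m)
  : {set {set 'rV[F]_m}} := [set L | is_line L && (a \in L)].

Definition line_point_err (R : realFieldType) (F : finFieldType) (m : nat)
  (f : 'rV[F]_m -> F) (P : {set 'rV[F]_m} -> 'rV[F]_m -> F) : R :=
  (#|'rV[F]_m|%:R)^-1 *
  \sum_(a : 'rV[F]_m)
     (#|lines_through a|%:R)^-1 *
     #|[set L in lines_through a | f a != P L a]|%:R.

Definition mpeval (F : finFieldType) (m : nat) (Q : {mpoly F[m]}) (a : 'rV[F]_m) : F :=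
  Q.@[fun i : 'I_m => a ord0 i].

Definition point_err (R : realFieldType) (F : finFieldType) (m : nat)
  (f : 'rV[F]_m -> F) (Q : {mpoly F[m]}) : R :=
  #|[set a : 'rV[F]_m | f a != mpeval Q a]|%:R / #|'rV[F]_m|%:R.

(* Main.v *)
(** Self-correction along lines combined with the Polishchuk-Spielman bivariate test.

    After replacing each line polynomial by the polynomial within the unique decoding
    radius of [f] on the line, when it exists, consider for a fixed [x] the bilinear
    surface [x + i h1 + j h2 + i j h3].  Its rows and columns with nonzero parameter are
    uniformly distributed lines, so on most surfaces the row and column polynomials agree
    on more than three quarters of the grid, and come from a single [Q] of bidegree
    [(d, d)]; hence the line polynomials through [x] in the directions [h2] and [h1] are
    [Q(0, .)] and [Q(., 0)], and both take the value [Q(0, 0)] at [x].  The common value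
    is [g x].  The same argument on the surfaces [x + i h + j h1 + i j h2] shows that [g]
    has degree at most [d] on every line, which forces total degree at most [d].

    For the bivariate test, a nonzero [E] of small bidegree vanishing on the disagreements
    makes [E] times the row (or column) polynomials the restrictions of one polynomial
    [P].  If [E] and [P] were coprime, their resultant would vanish to order [deg E] at too
    many points; so they have a common factor, and dividing it out repeatedly shows that
    [E] divides [P], with quotient [Q]. *)
Require Import Defs.
From HB Require Import structures.
From mathcomp Require Import all_boot all_order all_algebra all_field.
From mathcomp Require Import perm polyXY zify ring lra mpoly.
Set Implicit Arguments. Unset Strict Implicit. Unset Printing Implicit Defensive.
Import Order.TTheory GRing.Theory Num.Theory.
Local Open Scope ring_scope.

(** * Multiplicity of the roots of a determinant *)

Lemma size_det_leq (R : comNzRingType) n (M : 'M[{poly R}]_n) (w : 'I_n -> nat) :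
  (forall i j, (size (M i j) <= (w i).+1)%N) ->
  (size (\det M) <= (\sum_i w i).+1)%N.
Proof.
move=> szM; rewrite /determinant; apply: (leq_trans (size_sum _ _ _)).
apply/bigmax_leqP => s _; rewrite mulr_sign.
rewrite (fun_if (fun p : {poly R} => size p)) size_polyN if_same.
apply: leq_trans (size_prod_leq _ _) _.
have : (\sum_i size (M i (s i)) <= \sum_i (w i + 1))%N.
  by apply: leq_sum => i _; rewrite addn1.
by rewrite big_split /= sum_nat_const !card_ord muln1 leq_subLR addnS ltnS addnC.
Qed.

Lemma dvdp_det_rows (R : idomainType) n (M : 'M[{poly R}]_n) (p : {poly R}) (A : {set 'I_n}) :
  (forall i j, i \in A -> p %| M i j) -> p ^+ #|A| %| \det M.
Proof.
move=> dvM; apply: (big_ind (fun q => _ %| q)) => [|q r|s _]; first exact: dvdp0.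
  exact: dvdp_add.
rewrite dvdp_mull // (bigID (mem A)) dvdp_mulr //= -prodr_const.
by apply: (big_ind2 (fun q r => q %| r)) => // [q q' r r'|i /dvM]; first exact: dvdp_mul.
Qed.

Lemma dvdp_det_corank (F : fieldType) n (M : 'M[{poly F}]_n) (c : F) r :
  (\rank (map_mx (horner_eval c) M) + r <= n)%N ->
  ('X - c%:P) ^+ r %| \det M.
Proof.
set Mc := map_mx _ M => rk.
(* Constant row operations make the rows of index at least [\rank Mc] vanish at [c]. *)
pose L := map_mx polyC (invmx (col_ebase Mc)).
have evalLM : map_mx (horner_eval c) (L *m M) = pid_mx (\rank Mc) *m row_ebase Mc.
  rewrite map_mxM /= -/Mc -{1}[Mc]mulmx_ebase !mulmxA.
  have -> : map_mx (horner_eval c) L = invmx (col_ebase Mc).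
    by apply/matrixP => i j; rewrite !mxE /horner_eval hornerC.
  by rewrite mulVmx ?col_ebase_unit // mul1mx.
pose A := [set i : 'I_n | \rank Mc <= i]%N.
have cardA : (r <= #|A|)%N.
  rewrite cardsCs (_ : #|~: A| = \rank Mc) ?card_ord ?leq_subRL ?rank_leq_row //.
  rewrite -[RHS]card_ord -[RHS]sum1_card (big_ord_widen _ (fun=> 1%N) (rank_leq_row Mc)).
  by rewrite -sum1_card; apply: eq_bigl => i; rewrite !inE ltnNge.
have : ('X - c%:P) ^+ #|A| %| \det (L *m M).
  apply: dvdp_det_rows => i j; rewrite inE => rki; rewrite dvdp_XsubCl rootE.
  have /matrixP/(_ i j) := evalLM; rewrite !mxE /horner_eval => ->.
  by rewrite big1 // => k _; rewrite !mxE ltnNge rki andbF mul0r.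
rewrite det_mulmx det_map_mx mul_polyC dvdpZr; first exact/dvdp_trans/dvdp_exp2l.
by rewrite -unitfE -unitmxE unitmx_inv col_ebase_unit.
Qed.

Lemma max_poly_multiroots (F : fieldType) (p : {poly F}) (s : seq F) r :
  p != 0 -> uniq s -> (forall c, c \in s -> ('X - c%:P) ^+ r %| p) ->
  (size s * r < size p)%N.
Proof.
elim: s p => [|c s IHs] p p0 /=; first by rewrite mul0n size_poly_gt0.
case/andP=> cs us dv; have /dvdpP[p' pE] := dv c (mem_head c s).
have p'0 : p' != 0 by apply: contraNneq p0 => z; rewrite pE z mul0r.
have := IHs p' p'0 us; rewrite pE size_mul ?expf_neq0 ?polyXsubC_eq0 //.
rewrite size_exp_XsubC addnS mulSn addnC ltn_add2r; apply=> e es.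
have := dv e; rewrite inE es orbT pE Gauss_dvdpl; first exact.
apply/coprimep_expl/coprimep_expr/coprimep_XsubC2.
by rewrite subr_eq0; apply: contraNneq cs => ->.
Qed.

Lemma eq_poly_on (R : idomainType) (p q : {poly R}) (s : seq R) :
  uniq s -> (size p <= size s)%N -> (size q <= size s)%N ->
  {in s, forall x, p.[x] = q.[x]} -> p = q.
Proof.
move=> us sp sq e; apply/eqP; rewrite -subr_eq0; apply/eqP.
apply: (@roots_geq_poly_eq0 _ _ s) => //.
  by apply/allP => x /e ex; rewrite rootE hornerD hornerN ex subrr.
by rewrite (leq_trans (size_polyD _ _)) // size_polyN geq_max sp.
Qed.

(** * Degrees of bivariate polynomials *)

Lemma sizeY_swapXY (R : nzRingType) (P : {poly {poly R}}) : sizeY (swapXY P) = size P.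
Proof. by rewrite sizeYE swapXYK. Qed.

Lemma sizeY_leqP (R : nzRingType) (P : {poly {poly R}}) b :
  reflect (forall k, (size (P`_k)%R <= b)%N) (sizeY P <= b)%N.
Proof.
apply: (iffP idP) => [sP k|sP]; first exact: leq_trans (max_size_coefXY _ _) sP.
by apply/bigmax_leqP => k _.
Qed.

Lemma sizeY_mulXn (R : nzRingType) (P : {poly {poly R}}) n : sizeY (P * 'X^n) = sizeY P.
Proof. by elim: n => [|n IHn]; rewrite ?mulr1 // exprSr mulrA sizeY_mulX. Qed.

Lemma bivariate_const (R : nzRingType) (P : {poly {poly R}}) :
  (size P <= 1)%N -> (sizeY P <= 1)%N -> P = (P`_0`_0)%:P%:P.
Proof.
move=> /size1_polyC PE /sizeY_leqP/(_ 0)/size1_polyC P0E.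
by rewrite {1}PE {1}P0E.
Qed.

Lemma leq_size_mul2l (R : idomainType) (P Q Q' : {poly R}) n :
  P != 0 -> Q' != 0 -> (size (P * Q)%R <= size (P * Q')%R + n)%N -> (size Q <= size Q' + n)%N.
Proof.
move=> P0 Q'0; have [->|Q0] := eqVneq Q 0; first by rewrite size_poly0.
rewrite !size_mul //; move: P0 Q0 Q'0; rewrite -!size_poly_gt0.
by move: (size P) (size Q) (size Q'); lia.
Qed.

Lemma leq_sizeY_mul2l (R : idomainType) (P Q Q' : {poly {poly R}}) n :
  P != 0 -> Q' != 0 -> (sizeY (P * Q)%R <= sizeY (P * Q')%R + n)%N ->
  (sizeY Q <= sizeY Q' + n)%N.
Proof.
move=> P0 Q'0; rewrite !sizeYE !rmorphM /=.
by apply: leq_size_mul2l; rewrite swapXY_eq0.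
Qed.

Lemma horner2_coef_wide (R : comNzRingType) (P : {poly {poly R}}) a b x y :
  (size P <= a)%N -> (sizeY P <= b)%N ->
  P.[x, y] = \sum_(k < a) \sum_(l < b) P`_k`_l * (x ^+ k * y ^+ l).
Proof.
move=> sP /sizeY_leqP sPk; rewrite (horner_coef_wide _ sP) horner_sum.
apply: eq_bigr => k _; rewrite hornerM -rmorphXn hornerC (horner_coef_wide _ (sPk k)).
by rewrite mulr_suml; apply: eq_bigr => l _; ring.
Qed.

(** * Common factors of bivariate polynomials *)

Definition content (F : fieldType) (A : {poly {poly F}}) : {poly F} :=
  foldr (@gcdp F) 0 A.

Section Content.
Variable F : fieldType.
Implicit Types (c e : {poly F}) (A B E P G : {poly {poly F}}).

Lemma dvdp_contentP c A : reflect (forall k, c %| A`_k) (c %| content A).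
Proof.
have -> : (c %| content A) = all (fun p => c %| p) A.
  by rewrite /content; elim: (A : seq _) => [|p s IHs]; rewrite ?dvdp0 //= dvdp_gcd IHs.
apply: (iffP (all_nthP 0)) => cA k => [|_]; last exact: cA.
by case: (ltnP k (size A)) => [|le]; [apply: cA | rewrite nth_default ?dvdp0].
Qed.

Lemma dvdp_content_cons c A (a : {poly F}) :
  (c %| content (A * 'X + a%:P)) = (c %| a) && (c %| content A).
Proof.
rewrite -cons_poly_def; apply/dvdp_contentP/andP => [cAa|[ca /dvdp_contentP cA] [|k]].
- split; first by have := cAa 0; rewrite coef_cons.
  by apply/dvdp_contentP => k; have := cAa k.+1; rewrite coef_cons.
- by rewrite coef_cons.
- by rewrite coef_cons; apply: cA.
Qed.

Lemma dvdp_contentC c (a : {poly F}) : (c %| content a%:P) = (c %| a).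
Proof.
by apply/dvdp_contentP/idP => [/(_ 0)|ca [|k]]; rewrite coefC.
Qed.

Lemma dvdp_contentMX c A : (c %| content (A * 'X)) = (c %| content A).
Proof. by rewrite -[_ * _]addr0 dvdp_content_cons dvdp0. Qed.

Lemma dvdp_content_factor c A : c %| content A -> exists A', A = c *: A'.
Proof.
move/dvdp_contentP=> cA; exists (\poly_(k < size A) (A`_k %/ c)); apply/polyP => k.
rewrite coefZ coef_poly; case: ltnP => [_|/leq_sizeP/(_ k (leqnn _))->].
  by rewrite mulrC divpK.
by rewrite mulr0.
Qed.

Lemma dvdp_contentZ c e A : c != 0 -> (c * e %| content (c *: A)) = (e %| content A).
Proof.
by move=> c0; apply/dvdp_contentP/dvdp_contentP => eA k; move: (eA k); rewrite coefZ dvdp_mul2l.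
Qed.

Lemma dvdp_contentMr c A B : c %| content B -> c %| content (A * B).
Proof.
move=> /dvdp_content_factor[B' ->]; apply/dvdp_contentP => k.
by rewrite -scalerAr coefZ dvdp_mulr.
Qed.

Lemma dvdp_contentMl c A B : c %| content A -> c %| content (A * B).
Proof. by rewrite mulrC; apply: dvdp_contentMr. Qed.

Lemma dvdp_content_addl c A B : c %| content B -> (c %| content (A + B)) = (c %| content A).
Proof.
move/dvdp_contentP=> cB.
by apply/dvdp_contentP/dvdp_contentP => cA k; move: (cA k); rewrite coefD dvdp_addl.
Qed.

Lemma Gauss_dvdp_content_cons c A B (a : {poly F}) :
  coprimep c a -> c %| content ((A * 'X + a%:P) * B) -> c %| content B.
Proof.
move=> ca; elim/poly_ind: B => [|B b IHB] cAB; first by rewrite -polyC0 dvdp_contentC.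
have cb : c %| b.
  have /dvdp_contentP/(_ 0) := cAB.
  by rewrite coef0M !coefD !coefMX !coefC /= !add0r Gauss_dvdpr.
rewrite dvdp_content_cons cb IHB //; move: cAB.
by rewrite mulrDr mulrA dvdp_content_addl ?dvdp_contentMX // dvdp_contentMr ?dvdp_contentC.
Qed.

(* By induction on the degrees of [A] and [c]: with [a] the constant coefficient of [A],
   the factor [gcdp c a] of [c] divides [B] by the case of [(A - a) / 'X], and the
   cofactor is smaller than [c] unless [c] and [a] are coprime. *)
Lemma Gauss_dvdp_content c A B :
  c != 0 -> coprimep c (content A) -> c %| content (A * B) -> c %| content B.
Proof.
elim/poly_ind: A c B => [|A a IHA] c B c0.
  by rewrite /content polyseq0 /= coprimep0 => c1 _; apply: dvdUp.
have [n] := ubnP (size c); elim: n c B c0 => // n IHn c B c0 ltn cAa cAaB.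
have [ca|ca] := boolP (coprimep c a); first exact: Gauss_dvdp_content_cons ca cAaB.
set g := gcdp c a; have gc : g %| c := dvdp_gcdl c a; have ga : g %| a := dvdp_gcdr c a.
have /dvdpP[c' cE] := gc.
have [c'0 g0] : c' != 0 /\ g != 0 by apply/andP; rewrite -negb_or -mulf_eq0 -cE.
have /dvdp_content_factor[B' BE] : g %| content B.
  apply: IHA g0 _ _ => [|].
    apply/coprimepP => e eg eA; have /coprimepP := cAa; apply; first exact: dvdp_trans gc.
    by rewrite dvdp_content_cons eA (dvdp_trans eg ga).
  have := dvdp_trans gc cAaB; rewrite mulrDl mulrAC dvdp_content_addl ?dvdp_contentMX //.
  by rewrite dvdp_contentMl ?dvdp_contentC.
move: cAaB; rewrite BE -scalerAr cE [c' * g]mulrC !dvdp_contentZ //; apply: IHn => //.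
  have := size_mul c'0 g0; rewrite -cE; move: ltn ca g0; rewrite coprimep_def -size_poly_gt0 -/g.
  by move: (size c) (size c') (size g); lia.
by apply: coprimep_dvdr cAa; rewrite cE dvdp_mulr.
Qed.

Lemma primitive_part A :
  A != 0 -> exists c A', A = c *: A' /\ content A' %= 1.
Proof.
move=> A0; have [A' AE] := dvdp_content_factor (dvdpp (content A)).
have c0 : content A != 0 by apply: contraNneq A0 => c0; rewrite AE c0 scale0r.
exists (content A), A'; split=> //.
have := dvdpp (content A'); rewrite -(dvdp_contentZ _ _ c0) -AE.
by rewrite -[X in _ %| X]mulr1 dvdp_mul2l // dvdp1 size_poly_eq1.
Qed.

Lemma primitive_factor c A E S :
  c != 0 -> content A %= 1 -> c *: E = A * S -> exists E', E = A * E'.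
Proof.
move=> c0 A1 cE; have : c %| content S.
  apply: (@Gauss_dvdp_content c A) => //.
    by rewrite (eqp_coprimepr _ A1) coprimep1.
  by rewrite -cE -[X in X %| _]mulr1 dvdp_contentZ ?dvd1p.
case/dvdp_content_factor=> E' SE; exists E'; apply/eqP.
have : c%:P * (E - A * E') = 0.
  by rewrite mulrBr mul_polyC cE SE mulrCA mul_polyC subrr.
by move/eqP; rewrite mulf_eq0 polyC_eq0 (negPf c0) subr_eq0.
Qed.

Lemma common_factor_of_scaled c A E P S T :
  c != 0 -> c *: E = A * S -> c *: P = A * T -> (1 < size A)%N ->
  exists G E' P', [/\ (1 < size G)%N, E = G * E' & P = G * P'].
Proof.
move=> c0 cE cP sA.
have [|a [G [AE G1]]] := @primitive_part A; first by rewrite -size_poly_gt0 ltnW.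
have [E' EE] : exists E', E = G * E'.
  by apply: (primitive_factor c0 G1 (S := a *: S)); rewrite cE AE -scalerAl scalerAr.
have [P' PE] : exists P', P = G * P'.
  by apply: (primitive_factor c0 G1 (S := a *: T)); rewrite cP AE -scalerAl scalerAr.
by exists G, E', P'; split=> //; apply: leq_trans sA _; rewrite AE size_scale_leq.
Qed.

Lemma resultant0_common_factor E P :
  resultant E P = 0 -> exists G E' P', [/\ (1 < size G)%N, E = G * E' & P = G * P'].
Proof.
move/eqP; rewrite resultant_eq0 => sG.
have /Pdiv.WeakIdomain.dvdpP[[c S] /= c0 cE] := dvdp_gcdl E P.
have /Pdiv.WeakIdomain.dvdpP[[c' T] /= c'0 cP] := dvdp_gcdr E P.
apply: (@common_factor_of_scaled (c * c') (gcdp E P) E P (c' *: S) (c *: T)) => //.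
- by rewrite mulf_neq0.
- by rewrite mulrC -scalerA cE -scalerAr [S * _]mulrC.
- by rewrite -scalerA cP -scalerAr [T * _]mulrC.
Qed.

End Content.

Section CommonFactor.
Variable F : fieldType.
Implicit Types (E G P : {poly {poly F}}) (c : F) (d : nat) (s : seq F).

Definition quotient_at d E P c : Prop :=
  exists2 B : {poly F}, (size B <= d.+1)%N & P.[c%:P] = E.[c%:P] * B.

Lemma rank_Sylvester_eval E P c d :
  E != 0 -> size P = (size E + d)%N -> quotient_at d (swapXY E) (swapXY P) c ->
  (\rank (map_mx (horner_eval c) (Sylvester_mx E P)) <= (size P).-1)%N.
Proof.
move=> E0 szP [B szB]; rewrite !horner_swapXY.
set Ec := map_poly _ E; set Pc := map_poly _ P => PcE.
set nP := (size P).-1; set nE := (size E).-1.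
pose T := \matrix_(k < nP, j < nP + nE) ('X^k * Ec)`_j.
pose W := \matrix_(k < nE, l < nP) ('X^k * B)`_l.
suff -> : map_mx (horner_eval c) (Sylvester_mx E P) = col_mx 1%:M W *m T.
  exact: leq_trans (mulmx_max_rank _ _) _.
rewrite mul_col_mx mul1mx /Sylvester_mx map_col_mx; congr col_mx; apply/matrixP => k j.
  by rewrite !mxE /= rVpoly_delta !coefXnM (fun_if (horner_eval c)) coef_map rmorph0.
rewrite !mxE /= rVpoly_delta; under eq_bigr => l _ do rewrite !mxE.
have -> : horner_eval c ('X^k * P)`_j = ('X^k * Pc)`_j.
  by rewrite !coefXnM (fun_if (horner_eval c)) coef_map rmorph0.
have /take_poly_id Bk : (size ('X^k * B)%R <= nP)%N.
  apply: leq_trans (size_polyMleq _ _) _; rewrite size_polyXn /nP szP.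
  have := ltn_ord k; move: szB E0; rewrite -size_poly_gt0.
  move: (size E) (size B) (nat_of_ord k); lia.
rewrite PcE mulrCA -{1}Bk /take_poly poly_def mulr_sumr coef_sum.
by apply: eq_bigr => l _; rewrite -scalerAr coefZ [Ec * _]mulrC.
Qed.

Lemma resultant_eq0_of_quotients E P d e s :
  E != 0 -> size P = (size E + d)%N ->
  (sizeY E <= e.+1)%N -> (sizeY P <= (e + d).+1)%N -> uniq s ->
  {in s, forall c, quotient_at d (swapXY E) (swapXY P) c} ->
  ((size P).-1 * e + (size E).-1 * (e + d) < size s * (size E).-1)%N ->
  resultant E P = 0.
Proof.
move=> E0 szP sE sP us quot lt; apply: contraTeq lt => r0; rewrite -leqNgt -ltnS.
have root_mult c : c \in s -> ('X - c%:P) ^+ (size E).-1 %| resultant E P.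
  move=> cs; apply: dvdp_det_corank; rewrite leq_add2r.
  exact: rank_Sylvester_eval E0 szP (quot c cs).
apply: leq_trans (max_poly_multiroots r0 us root_mult) _.
pose w (i : 'I_((size P).-1 + (size E).-1)) := if split i is inl _ then e else (e + d)%N.
have wP i j : (size (Sylvester_mx E P i j) <= (w i).+1)%N.
  rewrite Sylvester_mxE /w; case: split => k /=; case: (k <= j)%N; rewrite ?size_poly0 //.
    exact: leq_trans (max_size_coefXY _ _) sE.
  exact: leq_trans (max_size_coefXY _ _) sP.
apply: leq_trans (size_det_leq wP) _; rewrite big_split_ord /=.
under eq_bigr => i _ do rewrite /w (unsplitK (inl i)).
under [X in (_ + X)%N]eq_bigr => i _ do rewrite /w (unsplitK (inr i)).
by rewrite !sum_nat_const !card_ord.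
Qed.

Lemma common_factor_of_quotients E P d s :
  E != 0 -> (size P <= size E + d)%N -> (sizeY P <= sizeY E + d)%N ->
  (sizeY E <= size E)%N -> (1 < size E)%N ->
  uniq s -> (2 * (sizeY E).-1 + 2 * d < size s)%N ->
  {in s, forall c, quotient_at d (swapXY E) (swapXY P) c} ->
  exists G E' P', [/\ (1 < size G)%N, E = G * E' & P = G * P'].
Proof.
move=> E0 sP sYP leYX sE us lts quot.
have sY0 : (0 < sizeY E)%N by rewrite lt0n sizeY_eq0.
(* Adding [E * 'X^d] to [P] gives it the exact size [size E + d], so that the Sylvester
   matrix has corank at least [deg E] at every point of [s], including those where the
   leading coefficient of [E] vanishes. *)
wlog szP : P sP sYP quot / size P = (size E + d)%N => [exact_size|].
  have [/exact_size|ltP] := eqVneq (size P) (size E + d)%N; first exact.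
  have szEX : size (E * 'X^d) = (size E + d)%N by rewrite size_mulXn // addnC.
  have szP : size (P + E * 'X^d) = (size E + d)%N.
    by rewrite addrC size_polyDl szEX // ltn_neqAle ltP.
  have [|||//|G [E' [P' [sG EE PE]]]] := exact_size (P + E * 'X^d).
  - by rewrite szP.
  - rewrite sizeYE rmorphD (leq_trans (size_polyD _ _)) //= -!sizeYE geq_max sYP.
    by rewrite sizeY_mulXn leq_addr.
  - move=> c /quot[B szB PcE]; exists (B + 'X^d).
      by rewrite (leq_trans (size_polyD _ _)) // geq_max szB size_polyXn /=.
    rewrite rmorphD rmorphM /= rmorphXn /= swapXY_X hornerD PcE !hornerM horner_exp hornerC.
    by rewrite -mulrDr.
  exists G, E', (P' - E' * 'X^d); split=> //.
  by rewrite mulrBr -PE mulrA -EE addrK.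
apply/resultant0_common_factor/(resultant_eq0_of_quotients (e := (sizeY E).-1) E0 szP) => //.
- by rewrite prednK.
- by move: sYP sY0; move: (sizeY E) (sizeY P); lia.
- exact: us.
- exact: quot.
- rewrite szP; move: lts leYX sE sY0; move: (size E) (sizeY E) (size s); nia.
Qed.

End CommonFactor.

(** * Divisibility and interpolation on grids *)

Section GridDivisibility.
Variable F : fieldType.
Implicit Types (E G P Q : {poly {poly F}}) (c : F) (d : nat) (I J s : seq F).

Lemma grid_common_factor E P d I J :
  E != 0 -> (size P <= size E + d)%N -> (sizeY P <= sizeY E + d)%N ->
  (2 < size E + sizeY E)%N -> uniq I -> uniq J ->
  (2 * (size E).-1 + 2 * d < size I)%N -> (2 * (sizeY E).-1 + 2 * d < size J)%N ->
  {in I, forall x, quotient_at d E P x} ->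
  {in J, forall y, quotient_at d (swapXY E) (swapXY P) y} ->
  exists G E' P', [/\ (2 < size G + sizeY G)%N, E = G * E' & P = G * P'].
Proof.
move=> E0 sP sYP sE uI uJ ltI ltJ quotI quotJ.
have [leYX|ltXY] := leqP (sizeY E) (size E).
  have [|G [E' [P' [sG EE PE]]]] := common_factor_of_quotients E0 sP sYP leYX _ uJ ltJ quotJ.
    by move: sE leYX; move: (size E) (sizeY E); lia.
  exists G, E', P'; split=> //.
  by rewrite -addn1 leq_add // lt0n sizeY_eq0; apply: contraNneq E0 => G0; rewrite EE G0 mul0r.
have := @common_factor_of_quotients F (swapXY E) (swapXY P) d I.
rewrite !sizeY_swapXY -!sizeYE swapXY_eq0 !swapXYK.
case/(_ E0 sYP sP (ltnW ltXY) _ uI ltI quotI) => [|G [E' [P' [sG EE PE]]]].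
  by move: sE ltXY; move: (size E) (sizeY E); lia.
exists (swapXY G), (swapXY E'), (swapXY P'); rewrite -!rmorphM /= -EE -PE !swapXYK; split=> //.
rewrite sizeY_swapXY -sizeYE addnC -addn1 leq_add // lt0n sizeY_eq0.
by apply: contraNneq E0 => G0; rewrite -swapXY_eq0 EE G0 mul0r.
Qed.

Lemma quotient_at_mul d G E P c :
  G.[c%:P] != 0 -> quotient_at d (G * E) (G * P) c -> quotient_at d E P c.
Proof.
move=> Gc [B szB]; rewrite !hornerM -mulrA => /(mulfI Gc) PB.
by exists B.
Qed.

Lemma max_constant_roots G s :
  G != 0 -> uniq s -> {in s, forall c, G.[c%:P] = 0} -> (size s < size G)%N.
Proof.
move=> G0 us Gs; rewrite -(size_map polyC s); apply: max_poly_roots => //.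
  by apply/allP => _ /mapP[c cs ->]; rewrite rootE Gs.
by rewrite map_inj_uniq //; apply: polyC_inj.
Qed.

Lemma size_filter_nonroot G s :
  G != 0 -> uniq s -> (size s <= size [seq c <- s | G.[c%:P] != 0%R] + (size G).-1)%N.
Proof.
move=> G0 us; rewrite size_filter -(count_predC (fun c => G.[c%:P] != 0) s) leq_add2l.
rewrite -size_filter -ltnS prednK ?size_poly_gt0 //.
apply: max_constant_roots; rewrite ?filter_uniq // => c.
by rewrite mem_filter /= negbK => /andP[/eqP].
Qed.

(* Polishchuk and Spielman: both hypotheses on the sizes of [I] and [J] survive the division
   of [E] and [P] by a common factor, which costs at most one point per degree. *)
Lemma grid_divisibility E P d I J :
  E != 0 -> (size P <= size E + d)%N -> (sizeY P <= sizeY E + d)%N -> uniq I -> uniq J ->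
  (2 * (size E).-1 + 2 * d < size I)%N -> (2 * (sizeY E).-1 + 2 * d < size J)%N ->
  {in I, forall x, quotient_at d E P x} ->
  {in J, forall y, quotient_at d (swapXY E) (swapXY P) y} ->
  exists Q, P = E * Q.
Proof.
have [n] := ubnP (size E + sizeY E).
elim: n E P I J => // n IHn E P I J ltn E0 sP sYP uI uJ ltI ltJ quotI quotJ.
have [cstE|sE] := leqP (size E + sizeY E) 2.
  have [sE1 sYE1] : (size E <= 1)%N /\ (sizeY E <= 1)%N.
    have : (0 < size E)%N /\ (0 < sizeY E)%N by rewrite size_poly_gt0 lt0n sizeY_eq0.
    by move: cstE; move: (size E) (sizeY E); lia.
  have EE := bivariate_const sE1 sYE1.
  exists ((E`_0`_0)^-1%:P%:P * P); rewrite mulrA {1}EE -!polyCM divff ?mul1r //.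
  by apply: contraNneq E0 => k0; rewrite EE k0.
have [G [E' [P' [sG EE PE]]]] := grid_common_factor E0 sP sYP sE uI uJ ltI ltJ quotI quotJ.
have [G0 E'0] : G != 0 /\ E' != 0 by apply/andP; rewrite -negb_or -mulf_eq0 -EE.
suff [Q PQ] : exists Q, P' = E' * Q by exists Q; rewrite PE PQ EE mulrA.
have [sE'0 sYE'0] : (0 < size E')%N /\ (0 < sizeY E')%N by rewrite size_poly_gt0 lt0n sizeY_eq0.
have [sG0 sYG0] : (0 < size G)%N /\ (0 < sizeY G)%N by rewrite size_poly_gt0 lt0n sizeY_eq0.
have szE : size E = (size G + size E').-1 by rewrite EE size_mul.
have szYE : sizeY E = (sizeY G + sizeY E').-1.
  by rewrite !sizeYE EE rmorphM size_mul ?swapXY_eq0.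
apply: (IHn E' P' [seq x <- I | G.[x%:P] != 0] [seq y <- J | (swapXY G).[y%:P] != 0]) => //.
- by move: ltn sG; rewrite szE szYE; lia.
- by apply: (leq_size_mul2l G0); rewrite -?EE -?PE.
- by apply: (leq_sizeY_mul2l G0); rewrite -?EE -?PE.
- exact: filter_uniq.
- exact: filter_uniq.
- have := size_filter_nonroot G0 uI; move: ltI; rewrite szE.
  by move: (size [seq _ <- I | _]) sE'0 sG0; lia.
- have := @size_filter_nonroot (swapXY G) J; rewrite swapXY_eq0 -sizeYE => /(_ G0 uJ).
  by move: ltJ; rewrite szYE; move: (size [seq _ <- J | _]) sYE'0 sYG0; lia.
- move=> x; rewrite mem_filter => /andP[Gx /quotI]; rewrite EE PE.
  exact: quotient_at_mul.
- move=> y; rewrite mem_filter => /andP[Gy /quotJ]; rewrite EE PE !rmorphM /=.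
  exact: quotient_at_mul.
Qed.

End GridDivisibility.

Lemma lagrange_basis (F : fieldType) (s : seq F) :
  uniq s -> exists2 L : F -> {poly F}, {in s, forall x, (size (L x) <= size s)%N} &
    {in s &, forall x z, (L x).[z] = (x == z)%:R}.
Proof.
move=> us; pose p x : {poly F} := \prod_(z <- rem x s) ('X - z%:P).
exists (fun x => (p x).[x]^-1 *: p x) => [x xs|x z xs zs].
  rewrite (leq_trans (size_scale_leq _ _)) // size_prod_XsubC size_rem // prednK //.
  by case: (s) xs.
have root_p w : ((p x).[w] == 0) = (w \in rem x s) by rewrite -rootE root_prod_XsubC.
rewrite hornerZ; have [<-|xz] := eqVneq x z.
  by rewrite mulVf // root_p mem_rem_uniq // !inE eqxx.
by apply/eqP; rewrite mulf_eq0 root_p mem_rem_uniq // !inE [z == x]eq_sym xz zs orbT.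
Qed.

Lemma row_interpolation (F : fieldType) (s : seq F) (v : F -> {poly F}) b :
  uniq s -> {in s, forall x, (size (v x) <= b)%N} ->
  exists P : {poly {poly F}}, [/\ (size P <= size s)%N, (sizeY P <= b)%N &
    {in s, forall x, P.[x%:P] = v x}].
Proof.
move=> us szv; have [L szL LE] := lagrange_basis us.
exists (\sum_(x <- s) v x *: map_poly polyC (L x)); split.
- apply: leq_trans (size_sum _ _ _) _; apply/bigmax_leqP_seq => x xs _.
  by rewrite (leq_trans (size_scale_leq _ _)) // size_map_polyC szL.
- apply/sizeY_leqP => k; rewrite coef_sum; apply: leq_trans (size_sum _ _ _) _.
  apply/bigmax_leqP_seq => x xs _; rewrite coefZ coef_map mulrC mul_polyC.
  by rewrite (leq_trans (size_scale_leq _ _)) ?szv.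
- move=> z zs; rewrite horner_sum (bigD1_seq z) //= hornerZ horner_map /= LE // eqxx mulr1.
  rewrite big_seq_cond big1 ?addr0 // => x /andP[xs xz].
  by rewrite hornerZ horner_map /= LE // (negPf xz) mulr0.
Qed.

Lemma grid_interpolation (F : fieldType) (A B : F -> {poly F}) (I J : seq F) a b :
  uniq I -> uniq J -> (a <= size I)%N -> (b <= size J)%N ->
  {in I, forall x, (size (A x) <= b)%N} -> {in J, forall y, (size (B y) <= a)%N} ->
  {in I & J, forall x y, (A x).[y] = (B y).[x]} ->
  exists P : {poly {poly F}}, [/\ (size P <= a)%N, (sizeY P <= b)%N,
    {in I, forall x, P.[x%:P] = A x} & {in J, forall y, (swapXY P).[y%:P] = B y}].
Proof.
move=> uI uJ leI leJ szA szB AB.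
have subI x : x \in take a I -> x \in I by apply: mem_take.
have sIa : size (take a I) = a by rewrite size_takel.
have uIa : uniq (take a I) by apply: take_uniq.
have [|P [sP sYP PA]] := row_interpolation (v := A) (b := b) uIa.
  by move=> x /subI; apply: szA.
rewrite sIa in sP.
have PB y : y \in J -> (swapXY P).[y%:P] = B y.
  move=> yJ; apply: (eq_poly_on uIa); rewrite ?sIa ?szB //.
    by rewrite (leq_trans (max_size_evalC _ _)) ?sizeY_swapXY.
  by move=> x xI; rewrite horner2_swapXY PA // AB // subI.
exists P; split=> // x xI; apply: (eq_poly_on uJ).
- by rewrite (leq_trans (max_size_evalC _ _)) // (leq_trans sYP).
- exact: leq_trans (szA x xI) leJ.
- by move=> y yJ; rewrite -horner2_swapXY PB // AB.
Qed.

Lemma vanishing_bidegree (F : fieldType) (L : seq (F * F)) a b :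
  (size L < a.+1 * b.+1)%N ->
  exists E : {poly {poly F}}, [/\ E != 0, (size E <= a.+1)%N, (sizeY E <= b.+1)%N &
    {in L, forall xy, E.[xy.1, xy.2] = 0}].
Proof.
move=> szL.
pose monomials (xy : F * F) := \matrix_(k < a.+1, l < b.+1) (xy.1 ^+ k * xy.2 ^+ l).
pose M := \matrix_(i < a.+1 * b.+1, p < size L) mxvec (monomials (nth (0, 0) L p)) 0 i.
have [v vM v0] : exists2 v : 'rV_(a.+1 * b.+1), (v <= kermx M)%MS & v != 0.
  apply/rowV0Pn; rewrite -mxrank_eq0 mxrank_ker subn_eq0 -ltnNge.
  exact: leq_ltn_trans (rank_leq_col M) szL.
pose E := \poly_(k < a.+1) rVpoly (row (inord k) (vec_mx v)).
have coefE (k : 'I_a.+1) (l : 'I_b.+1) : E`_k`_l = v 0 (mxvec_index k l).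
  by rewrite coef_poly ltn_ord coef_rVpoly_ord !mxE inord_val.
have sYE : (sizeY E <= b.+1)%N.
  apply/sizeY_leqP => k; rewrite coef_poly; case: ifP => _; last by rewrite size_poly0.
  exact: size_poly.
exists E; split=> //; first 1 last.
- exact: size_poly.
- move=> xy xyL; have pL : (index xy L < size L)%N by rewrite index_mem.
  have /matrixP/(_ 0 (Ordinal pL)) : v *m M = 0 by apply/sub_kermxP.
  rewrite !mxE => <-; under eq_bigr => i _ do rewrite mxE /= nth_index //.
  rewrite (reindex _ (curry_mxvec_bij _ _)) (horner2_coef_wide _ _ (size_poly _ _) sYE).
  rewrite pair_bigA; apply: eq_bigr => -[k l] _ /=.
  by rewrite -coefE mxvecE mxE.
- apply: contraNneq v0 => E0; apply/eqP/rowP => i; rewrite mxE.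
  by case/mxvec_indexP: i => k l; rewrite -coefE E0 !coef0.
Qed.

(** * Averages over finite types *)

(* The junk value on an empty type is [0]. *)
Definition mean (R : realFieldType) (T : finType) (phi : T -> R) : R :=
  (\sum_t phi t) / #|T|%:R.

Notation "\mean_ t E" := (mean (fun t => E))
  (at level 36, t binder, E at level 36, format "'[' \mean_ t  '/  ' E ']'") : ring_scope.

Section Mean.
Variable R : realFieldType.
Implicit Types (S T : finType) (c : R).

Lemma eq_mean T (phi psi : T -> R) : phi =1 psi -> mean phi = mean psi.
Proof. by move=> e; rewrite /mean (eq_bigr _ (fun t _ => e t)). Qed.

Lemma ler_mean T (phi psi : T -> R) : (forall t, phi t <= psi t) -> mean phi <= mean psi.
Proof. by move=> le; rewrite ler_wpM2r ?invr_ge0 ?ler0n ?ler_sum. Qed.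

Lemma mean_const T c : (0 < #|T|)%N -> \mean_(t : T) c = c.
Proof.
by move=> T0; rewrite /mean sumr_const -[c *+ _]mulr_natr mulfK // pnatr_eq0 -lt0n.
Qed.

Lemma mean_ge0 T (phi : T -> R) : (forall t, 0 <= phi t) -> 0 <= mean phi.
Proof. by move=> phi0; rewrite mulr_ge0 ?invr_ge0 ?ler0n ?sumr_ge0. Qed.

Lemma mean_le T (phi : T -> R) c : 0 <= c -> (forall t, phi t <= c) -> mean phi <= c.
Proof.
move=> c0 le; have [T0|T0] := posnP #|T|; first by rewrite /mean T0 invr0 mulr0.
by rewrite -[leRHS](mean_const c T0) ler_mean.
Qed.

Lemma meanD T (phi psi : T -> R) : \mean_t (phi t + psi t) = mean phi + mean psi.
Proof. by rewrite /mean big_split mulrDl. Qed.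

Lemma meanZ T c (phi : T -> R) : \mean_t (c * phi t) = c * mean phi.
Proof. by rewrite /mean -mulr_sumr mulrA. Qed.

Lemma exchange_mean S T (phi : S -> T -> R) :
  \mean_s \mean_t phi s t = \mean_t \mean_s phi s t.
Proof.
rewrite /mean -!mulr_suml exchange_big /=.
by rewrite -mulrA [#|T|%:R^-1 * _]mulrC mulrA.
Qed.

Lemma mean_pair S T (phi : S * T -> R) : mean phi = \mean_s \mean_t phi (s, t).
Proof.
rewrite /mean -mulr_suml -mulrA -invfM -natrM [(#|T| * _)%N]mulnC -card_prod.
by rewrite pair_bigA /=; congr (_ / _); apply: eq_bigr; case.
Qed.

Lemma mean_exchange_le S T (phi : S -> T -> R) c :
  0 <= c -> (forall t, \mean_s phi s t <= c) -> \mean_s \mean_t phi s t <= c.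
Proof. by move=> c0 le; rewrite exchange_mean mean_le. Qed.

Lemma reindex_mean T (h : T -> T) (phi : T -> R) : injective h -> \mean_t phi (h t) = mean phi.
Proof. by move=> inj_h; rewrite /mean [in RHS](reindex_inj inj_h). Qed.

Lemma mean_indicator T (P : pred T) : \mean_t (P t)%:R = #|[set t | P t]|%:R / #|T|%:R :> R.
Proof.
rewrite /mean -natr_sum; congr (_%:R / _).
by rewrite -sum1_card [RHS]big_mkcond; apply: eq_bigr => t _; rewrite inE; case: (P t).
Qed.

Lemma mean_indicator_ge0 T (P : pred T) : 0 <= \mean_t (P t)%:R :> R.
Proof. by apply: mean_ge0 => t; apply: ler0n. Qed.

Lemma mean_indicator_le1 T (P : pred T) : \mean_t (P t)%:R <= 1 :> R.
Proof. by apply: mean_le => // t; rewrite lern1; case: (P t). Qed.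

Lemma exists_le_mean T (phi : T -> R) : (0 < #|T|)%N -> exists t, phi t <= mean phi.
Proof.
move=> T0; apply/existsP; apply: contraT => /existsPn ltphi.
suff : mean phi < mean phi by rewrite ltxx.
rewrite -{1}(mean_const (mean phi) T0) /mean ltr_pM2r ?invr_gt0 ?ltr0n //.
have /card_gt0P[t0 _] := T0; apply: ltr_sum; last by move=> t _; rewrite ltNge ltphi.
by apply/hasP; exists t0; rewrite ?mem_index_enum.
Qed.

Lemma mean_le_except T (phi : T -> R) t0 c :
  0 <= c -> phi t0 <= 1 -> (forall t, t != t0 -> phi t <= c) -> mean phi <= c + #|T|%:R^-1.
Proof.
move=> c0 le1 lec; have T0 : (0 < #|T|)%N by apply/card_gt0P; exists t0.
have cT : c = \mean_(t : T) c by rewrite mean_const.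
rewrite cT -[X in _ + X]mul1r -mulrDl ler_wpM2r ?invr_ge0 ?ler0n //.
rewrite (bigD1 t0) //= addrC lerD // [leRHS](bigD1 t0) //= -[leLHS]add0r lerD //.
by apply: ler_sum => t /lec.
Qed.

Lemma mean_triple_le1 S T (U : finType) (phi : S -> T -> U -> R) c :
  0 <= c -> (forall s, \mean_t \mean_u phi s t u <= c) ->
  \mean_(h : S * T * U) phi h.1.1 h.1.2 h.2 <= c.
Proof. by move=> c0 le; rewrite !mean_pair /=; apply: mean_le. Qed.

Lemma mean_triple_le2 S T (U : finType) (phi : S -> T -> U -> R) c :
  0 <= c -> (forall t, \mean_s \mean_u phi s t u <= c) ->
  \mean_(h : S * T * U) phi h.1.1 h.1.2 h.2 <= c.
Proof. by move=> c0 le; rewrite !mean_pair /=; apply: mean_exchange_le. Qed.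

Lemma mean_affine (F : finFieldType) (m : nat) (x : 'rV[F]_m) (i : F) (phi : 'rV[F]_m -> R) :
  i != 0 -> \mean_h phi (x + i *: h) = mean phi.
Proof.
by move=> i0; apply: (reindex_mean _ (h := fun h => x + i *: h)) => h h' /addrI; apply: scalerI.
Qed.

Lemma ler_neq_triangle (T : eqType) (x y z : T) :
  (x != z)%:R <= (x != y)%:R + (y != z)%:R :> R.
Proof.
have [->|_] := eqVneq x y; first by rewrite add0r.
by case: (x != z); case: (y != z) => /=; lra.
Qed.

Lemma ler_neq_app (S T : eqType) (h : S -> T) x y : (h x != h y)%:R <= (x != y)%:R :> R.
Proof. by have [->|_] := eqVneq x y; rewrite ?eqxx // ler_nat; case: (h x != h y). Qed.

End Mean.

Lemma card_zmod_gt0 (V : finZmodType) : (0 < #|V|)%N.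
Proof. by apply/card_gt0P; exists 0. Qed.

Lemma degree_ratio_le (R : realFieldType) (F : finFieldType) c d :
  (0 < c)%N -> (c * d < #|F|)%N -> d%:R / #|F|%:R <= c%:R^-1 :> R.
Proof.
move=> c0 ltq; rewrite ler_pdivrMr ?ltr0n ?card_zmod_gt0 // ler_pdivlMl ?ltr0n //.
by rewrite -natrM ler_nat ltnW.
Qed.

Lemma inv_card_le (R : realFieldType) (F : finFieldType) c d :
  (0 < c)%N -> (0 < d)%N -> (c * d < #|F|)%N -> #|F|%:R^-1 <= c%:R^-1 :> R.
Proof.
move=> c0 d0 ltq; apply: le_trans (degree_ratio_le R c0 ltq).
by rewrite ler_peMl ?invr_ge0 ?ler0n ?ler1n.
Qed.

(** * The bivariate low-degree test *)

Lemma mean_poly_neq (R : realFieldType) (F : finFieldType) (p p' : {poly F}) d :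
  (size p <= d.+1)%N -> (size p' <= d.+1)%N -> p != p' ->
  1 - d%:R / #|F|%:R <= \mean_x (p.[x] != p'.[x])%:R :> R.
Proof.
move=> sp sp' pp'; have q0 : 0 < #|F|%:R :> R by rewrite ltr0n card_zmod_gt0.
rewrite mean_indicator lerBlDr -mulrDl ler_pdivlMr // mul1r -natrD ler_nat.
rewrite -(cardsC [set x | p.[x] != p'.[x]]) leq_add2l leqNgt; apply: contra pp' => lt.
apply/eqP/(@eq_poly_on _ _ _ (enum (~: [set x | p.[x] != p'.[x]]))); rewrite ?enum_uniq -?cardE //.
- exact: leq_trans lt.
- exact: leq_trans lt.
- by move=> x; rewrite mem_enum !inE negbK => /eqP.
Qed.

Definition grid_disagreement (R : realFieldType) (F : finFieldType) (A B : F -> {poly F}) : R :=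
  \mean_x \mean_y ((A x).[y] != (B y).[x])%:R.

Lemma grid_disagreementE (R : realFieldType) (F : finFieldType) (A B : F -> {poly F}) :
  grid_disagreement R A B =
    #|[set xy : F * F | (A xy.1).[xy.2] != (B xy.2).[xy.1]]|%:R / (#|F|%:R * #|F|%:R).
Proof. by rewrite -natrM -card_prod -mean_indicator mean_pair. Qed.

Lemma grid_disagreementC (R : realFieldType) (F : finFieldType) (A B : F -> {poly F}) :
  grid_disagreement R A B = grid_disagreement R B A.
Proof.
rewrite /grid_disagreement exchange_mean; apply: eq_mean => y; apply: eq_mean => x.
by rewrite eq_sym.
Qed.

Lemma card_mismatch (F : finFieldType) (v : F -> {poly F}) (E Q : {poly {poly F}}) a :
  E != 0 -> (size E <= a.+1)%N -> (forall x, (E * Q).[x%:P] = E.[x%:P] * v x) ->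
  (#|[set x | Q.[x%:P] != v x]| <= a)%N.
Proof.
move=> E0 sE EQ; rewrite -ltnS; apply: leq_trans sE.
rewrite cardE; apply: max_constant_roots; rewrite ?enum_uniq // => x.
rewrite mem_enum inE; apply: contraNeq => Ex; apply/eqP/(mulfI Ex).
by rewrite -hornerM.
Qed.

Section BivariateTest.
Variables (R : realFieldType) (F : finFieldType) (d : nat) (A B : F -> {poly F}).
Hypotheses (szA : forall x, (size (A x) <= d.+1)%N) (szB : forall y, (size (B y) <= d.+1)%N).
Implicit Types E Q : {poly {poly F}}.

Lemma bivariate_interpolant a :
  (2 * a + 2 * d < #|F|)%N ->
  (#|[set xy : F * F | (A xy.1).[xy.2] != (B xy.2).[xy.1]]| < a.+1 * a.+1)%N ->
  exists E Q, [/\ E != 0, (size E <= a.+1)%N && (sizeY E <= a.+1)%N,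
    (size Q <= d.+1)%N && (sizeY Q <= d.+1)%N,
    forall x, (E * Q).[x%:P] = E.[x%:P] * A x &
    forall y, (swapXY (E * Q)).[y%:P] = (swapXY E).[y%:P] * B y].
Proof.
set errors := [set xy | _] => ltq lt_errors.
have [|E [E0 sE sYE Eerr]] := @vanishing_bidegree F (enum errors) a a; first by rewrite -cardE.
have EAB x y : (E.[x%:P] * A x).[y] = ((swapXY E).[y%:P] * B y).[x].
  rewrite !hornerM horner2_swapXY; have [->//|ne] := eqVneq (A x).[y] (B y).[x].
  by rewrite (Eerr (x, y)) ?mul0r // mem_enum inE.
have szEM (p p' : {poly F}) n :
    (size p <= n)%N -> (size p' <= d.+1)%N -> (size (p * p')%R <= n + d)%N.
  move=> sp sp'; apply: leq_trans (size_polyMleq _ _) _.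
  by move: sp sp'; move: (size p) (size p'); lia.
have uF := enum_uniq F; have sF : size (enum F) = #|F| by rewrite -cardE.
have [|||||P [sP sYP PA PB]] := @grid_interpolation F (fun x => E.[x%:P] * A x)
    (fun y => (swapXY E).[y%:P] * B y) _ _ (size E + d) (sizeY E + d) uF uF.
- by rewrite sF; move: sE ltq; move: (size E); lia.
- by rewrite sF; move: sYE ltq; move: (sizeY E); lia.
- by move=> x _; rewrite szEM // max_size_evalC.
- by move=> y _; rewrite szEM // -sizeY_swapXY max_size_evalC.
- by move=> x y _ _; apply: EAB.
have [||||Q PQ] := grid_divisibility (I := enum F) (J := enum F) E0 sP sYP uF uF.
- by rewrite sF; move: sE ltq; move: (size E); lia.
- by rewrite sF; move: sYE ltq; move: (sizeY E); lia.
- by move=> x xF; exists (A x); rewrite // PA.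
- by move=> y yF; exists (B y); rewrite // PB.
exists E, Q; split; rewrite ?sE ?sYE -?PQ //.
- apply/andP; split.
    have := @leq_size_mul2l _ E Q 1 d E0 (oner_neq0 _); rewrite mulr1 -PQ size_poly1; exact.
  have := @leq_sizeY_mul2l _ E Q 1 d E0 (oner_neq0 _).
  rewrite mulr1 -PQ (_ : sizeY 1 = 1%N) ?[LHS]sizeYE ?rmorph1 ?size_poly1 //; exact.
- by move=> x; rewrite PA // mem_enum.
- by move=> y; rewrite PB // mem_enum.
Qed.

Lemma column_disagreement Q :
  (size Q <= d.+1)%N ->
  (1 - d%:R / #|F|%:R - \mean_x (Q.[x%:P] != A x)%:R) * \mean_y ((swapXY Q).[y%:P] != B y)%:R
    <= grid_disagreement R A B.
Proof.
move=> sQ; rewrite /grid_disagreement exchange_mean -meanZ; apply: ler_mean => y.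
have [_|QB] := eqVneq (swapXY Q).[y%:P] (B y).
  by rewrite mulr0 mean_ge0 // => x; rewrite ler0n.
rewrite mulr1 lerBlDl -meanD; apply: le_trans (mean_poly_neq R _ (szB y) QB) _.
  by rewrite (leq_trans (max_size_evalC _ _)) ?sizeY_swapXY.
apply: ler_mean => x; rewrite horner2_swapXY; apply: le_trans (ler_neq_triangle _ _ (A x).[y] _) _.
by rewrite lerD2r (ler_neq_app R (horner^~ y)).
Qed.

End BivariateTest.

Lemma bivariate_test_of_degree (R : realFieldType) (F : finFieldType) (A B : F -> {poly F}) d a :
  (forall x, (size (A x) <= d.+1)%N) -> (forall y, (size (B y) <= d.+1)%N) ->
  (2 * a + 2 * d < #|F|)%N ->
  grid_disagreement R A B * (#|F|%:R * #|F|%:R) < a.+1%:R * a.+1%:R ->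
  exists Q : {poly {poly F}}, [/\ (size Q <= d.+1)%N, (sizeY Q <= d.+1)%N,
    \mean_x (Q.[x%:P] != A x)%:R <= 2 * grid_disagreement R A B &
    \mean_y ((swapXY Q).[y%:P] != B y)%:R <= 2 * grid_disagreement R A B].
Proof.
move=> szA szB lta ltD; have q0 : 0 < #|F|%:R :> R by rewrite ltr0n card_zmod_gt0.
have [|E [Q [E0 /andP[sE sYE] /andP[sQ sYQ] EA EB]]] := bivariate_interpolant szA szB lta.
  move: ltD; rewrite grid_disagreementE divfK ?mulf_neq0 ?lt0r_neq0 //.
  by rewrite -natrM ltr_nat.
have twice (k : nat) (v : R) : (k <= a)%N -> 0 <= v ->
    (1 - d%:R / #|F|%:R - k%:R / #|F|%:R) * v <= grid_disagreement R A B ->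
    v <= 2 * grid_disagreement R A B.
  move=> ka v0; suff half : 2^-1 <= 1 - d%:R / #|F|%:R - k%:R / #|F|%:R :> R by nra.
  rewrite -addrA -opprD -mulrDl lerBrDr -lerBrDl ler_pdivrMr //.
  have : 2 * (d%:R + k%:R) <= #|F|%:R :> R by rewrite -natrD -natrM ler_nat; lia.
  lra.
exists Q; split=> //.
- have := @column_disagreement R F d B A szA (swapXY Q); rewrite -sizeYE swapXYK => /(_ sYQ).
  rewrite -grid_disagreementC mean_indicator; apply: twice; last exact: mean_indicator_ge0.
  by apply: (card_mismatch (E := swapXY E)); rewrite ?swapXY_eq0 -?sizeYE -?rmorphM.
- have := @column_disagreement R F d A B szB Q sQ.
  rewrite mean_indicator; apply: twice; last exact: mean_indicator_ge0.
  exact: card_mismatch EA.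
Qed.

Theorem bivariate_low_degree_test (R : realFieldType) (F : finFieldType) (A B : F -> {poly F}) d :
  (forall x, (size (A x) <= d.+1)%N) -> (forall y, (size (B y) <= d.+1)%N) ->
  (2 * d < #|F|)%N -> grid_disagreement R A B < (2^-1 - d%:R / #|F|%:R) ^+ 2 ->
  exists Q : {poly {poly F}}, [/\ (size Q <= d.+1)%N, (sizeY Q <= d.+1)%N,
    \mean_x (Q.[x%:P] != A x)%:R <= 2 * grid_disagreement R A B &
    \mean_y ((swapXY Q).[y%:P] != B y)%:R <= 2 * grid_disagreement R A B].
Proof.
move=> szA szB ltq ltD; set q := #|F| in ltq ltD *.
have q0 : 0 < q%:R :> R by rewrite ltr0n card_zmod_gt0.
pose a := (q - 2 * d - 1)./2.
apply: (@bivariate_test_of_degree R F A B d a) => //; first by rewrite -/q /a; lia.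
have lea : q%:R <= 2 * a.+1%:R + 2 * d%:R :> R.
  by rewrite -!natrM -natrD ler_nat /a; lia.
have led : 2 * d%:R <= q%:R :> R by rewrite -natrM ler_nat ltnW.
rewrite -ltr_pdivlMr ?mulr_gt0 // -/q; apply: lt_le_trans ltD _.
rewrite ler_pdivlMr ?mulr_gt0 //.
have -> : (2^-1 - d%:R / q%:R) ^+ 2 * (q%:R * q%:R) = ((q%:R - 2 * d%:R) / 2) ^+ 2 :> R.
  by field; rewrite lt0r_neq0.
by nra.
Qed.

(** * Degree on lines and total degree *)

Lemma sizeY_leq_evals (R : idomainType) (P : {poly {poly R}}) (s : seq R) n :
  uniq s -> (size P <= size s)%N -> {in s, forall c, (size P.[c%:P] <= n)%N} ->
  (sizeY P <= n)%N.
Proof.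
move=> us sP evals; rewrite sizeYE; apply/leq_sizeP => k nk.
apply: (@roots_geq_poly_eq0 _ _ s) => //.
  apply/allP => c /evals sPc; rewrite rootE -[_.[c]]/(horner_eval c _) -coef_map -horner_polyC.
  by rewrite nth_default // (leq_trans sPc).
by rewrite (leq_trans (max_size_coefXY _ _)) // sizeY_swapXY.
Qed.

(* [A.[c *: 'X]] is the restriction of [A(t, s)] to the line [t = c s]. *)
Lemma size_coef_of_slopes (F : fieldType) (A : {poly {poly F}}) (s : seq F) n :
  uniq s -> (size A <= size s)%N -> {in s, forall c, (size A.[c *: 'X] <= n)%N} ->
  forall e, (size (A`_e)%R <= n - e)%N.
Proof.
move=> us sA slopes e; pose H := \poly_(k < size A) (A`_k * 'X^k).
have /sizeY_leqP/(_ e) : (sizeY H <= n)%N.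
  apply: (sizeY_leq_evals us) => [|c /slopes]; first exact: leq_trans (size_poly _ _) sA.
  suff -> : H.[c%:P] = A.[c *: 'X] by [].
  rewrite horner_poly horner_coef; apply: eq_bigr => k _.
  by rewrite exprZn -mulrA -rmorphXn [_ * (c ^+ k)%:P]mulrC mul_polyC.
rewrite coef_poly; case: ltnP => [_|leAe]; last by rewrite (nth_default _ leAe) size_poly0.
have [->|Ae0] := eqVneq A`_e 0; first by rewrite size_poly0.
by rewrite size_mulXn // => /leq_sub2r-/(_ e); rewrite addKn.
Qed.

Definition line_degree (F : finFieldType) (m d : nat) (g : 'rV[F]_m -> F) : Prop :=
  forall a u, exists2 p : {poly F}, (size p <= d.+1)%N & forall t, g (a + t *: u) = p.[t].

Section LineDegree.
Variables (F : finFieldType) (m : nat).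
Implicit Types (d : nat) (g : 'rV[F]_m -> F) (a b u v : 'rV[F]_m).

Lemma line_degree_along d g v :
  line_degree d g -> exists2 p : 'rV[F]_m -> {poly F}, forall a, (size (p a) <= d.+1)%N &
    forall a t, g (a + t *: v) = (p a).[t].
Proof.
move=> dg; have /fin_all_exists2[p sp pE] a : exists2 p : {poly F}, (size p <= d.+1)%N &
    forall t, g (a + t *: v) = p.[t] by apply: dg.
by exists p.
Qed.

Lemma line_degree_plane d g a u v :
  (2 * d < #|F|)%N -> line_degree d g ->
  exists2 A : {poly {poly F}}, (size A <= d.+1)%N /\ (forall e, (size (A`_e)%R <= d.+1 - e)%N) &
    forall s t, g (a + s *: u + t *: v) = A.[t, s].
Proof.
move=> ltq dg; have uF := enum_uniq F; have sF : size (enum F) = #|F| by rewrite -cardE.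
have le_d1 : (d.+1 <= size (enum F))%N by rewrite sF; lia.
have [pu spu puE] := line_degree_along u dg; have [pv spv pvE] := line_degree_along v dg.
have [|A [sA sYA rowA _]] := @grid_interpolation F (fun t => pu (a + t *: v))
    (fun s => pv (a + s *: u)) _ _ d.+1 d.+1 uF uF le_d1 le_d1
    (in1W (fun t => spu _)) (in1W (fun s => spv _)).
  by move=> t s _ _; rewrite -puE -pvE addrAC.
have gA s t : g (a + s *: u + t *: v) = A.[t, s] by rewrite rowA ?mem_enum // -puE addrAC.
exists A => //; split=> //; apply: (size_coef_of_slopes uF (leq_trans sA le_d1)) => c _.
have [p sp pE] := dg a (u + c *: v); suff -> : A.[c *: 'X] = p by [].
apply: (eq_poly_on uF) => [||s _]; last 1 first.
- rewrite -pE scalerDr scalerA addrA gA !(horner_coef_wide _ sA) !horner_sum.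
  by apply: eq_bigr => e _; rewrite !hornerM !horner_exp !hornerE [c * s]mulrC.
- rewrite (horner_coef_wide _ sA); apply: leq_trans (size_sum _ _ _) _.
  apply/bigmax_leqP => e _; rewrite exprZn -scalerAr (leq_trans (size_scale_leq _ _)) //.
  rewrite (leq_trans (size_polyMleq _ _)) // size_polyXn addnS sF /=.
  have := leq_trans (max_size_coefXY A e) sYA; have := ltn_ord e.
  by move: ltq; move: (size A`_e) #|F|; lia.
- exact: leq_trans sp le_d1.
Qed.

Lemma line_degree_coef d g v (p : 'rV[F]_m -> {poly F}) e :
  (2 * d < #|F|)%N -> line_degree d g -> (forall a, (size (p a) <= d.+1)%N) ->
  (forall a t, g (a + t *: v) = (p a).[t]) -> (e <= d)%N ->
  line_degree (d - e) (fun a => (p a)`_e).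
Proof.
move=> ltq dg sp pE led a u; have [A [sA sAe] gA] := line_degree_plane a u v ltq dg.
exists A`_e => [|s]; first by rewrite -subSn.
suff -> : p (a + s *: u) = (swapXY A).[s%:P] by rewrite horner_swapXY coef_map.
have le_d1 : (d.+1 <= size (enum F))%N by rewrite -cardT (leq_ltn_trans _ ltq) ?leq_pmull.
apply: (eq_poly_on (enum_uniq F)); rewrite ?(leq_trans (sp _)) //.
  by rewrite (leq_trans (max_size_evalC _ _)) // sizeY_swapXY (leq_trans sA).
by move=> t _; rewrite -pE gA horner2_swapXY.
Qed.

Lemma msize_sum_mulX (i : 'I_m) d (Q : 'I_d.+1 -> {mpoly F[m]}) :
  (forall e, (msize (Q e) <= (d - e).+1)%N) -> (msize (\sum_e Q e * 'X_i ^+ e) <= d.+1)%N.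
Proof.
move=> sQ; apply: leq_trans (mmeasure_sum _ _ _ _) _; apply/bigmax_leqP => e _.
have [->|Qe0] := eqVneq (Q e) 0; first by rewrite mul0r msize0.
have sX : msize ('X_i ^+ e : {mpoly F[m]}) = e.+1.
  by rewrite mpolyXn msizeX mdegMn mdeg1 mul1n.
rewrite msizeM // -?msize_poly_eq0 ?sX //.
by have := sQ e; have := ltn_ord e; move: (msize _) (nat_of_ord e); lia.
Qed.

Lemma line_degree_mpoly_of_coords k d g :
  (2 * d < #|F|)%N -> line_degree d g ->
  (forall a b, (forall i : 'I_m, (i < k)%N -> a 0 i = b 0 i) -> g a = g b) ->
  exists2 Q : {mpoly F[m]}, (msize Q <= d.+1)%N & forall a, g a = mpeval Q a.
Proof.
elim: k d g => [|k IHk] d g ltq dg depg.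
  exists ((g 0)%:MP) => [|a]; first by rewrite mmeasureC; case: (_ != _).
  by rewrite /mpeval mevalC; apply: depg.
have [ltkm|lemk] := ltnP k m; last first.
  apply: IHk => // a b ab; apply: depg => i _; apply: ab.
  exact: leq_trans (ltn_ord i) lemk.
pose i0 := Ordinal ltkm; pose e0 : 'rV[F]_m := delta_mx 0 i0.
pose proj (a : 'rV[F]_m) := a - a 0 i0 *: e0.
have [p sp pE] := line_degree_along e0 dg.
have le_d1 : (d.+1 <= size (enum F))%N by rewrite -cardT (leq_ltn_trans _ ltq) ?leq_pmull.
have coef_dep e a b : (forall i : 'I_m, (i < k)%N -> a 0 i = b 0 i) ->
    (p (proj a))`_e = (p (proj b))`_e.
  move=> ab; suff -> : p (proj a) = p (proj b) by [].
  apply: (eq_poly_on (enum_uniq F)) => [||t _]; rewrite ?(leq_trans (sp _)) // -!pE.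
  apply: depg => i lti; rewrite !mxE eqxx /=.
  have [->|ne] := eqVneq i i0; first by rewrite !mulr1 !subrr.
  rewrite !mulr0 !subr0 ab // ltn_neqAle -ltnS lti andbT.
  by apply: contraNneq ne => ik; apply/eqP/val_inj.
have /fin_all_exists2[Q sQ QE] (e : 'I_d.+1) : exists2 Q : {mpoly F[m]},
    (msize Q <= (d - e).+1)%N & forall a, (p (proj a))`_e = mpeval Q a.
  apply: IHk (coef_dep e); first by lia.
  move=> a u; have led : (e <= d)%N by rewrite -ltnS.
  have [r sr rE] := line_degree_coef ltq dg sp pE led (proj a) (proj u).
  exists r => // t; rewrite -rE; suff -> : proj (a + t *: u) = proj a + t *: proj u by [].
  by rewrite /proj !mxE scalerBr scalerDl opprD scalerA addrACA.
exists (\sum_e Q e * 'X_i0 ^+ e) => [|a]; first exact: msize_sum_mulX.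
have -> : g a = (p (proj a)).[a 0 i0] by rewrite -pE subrK.
rewrite (horner_coef_wide _ (sp _)) /mpeval raddf_sum; apply: eq_bigr => e _.
by rewrite /= mevalM rmorphXn /= mevalXU QE.
Qed.

Lemma line_degree_mpoly d g :
  (2 * d < #|F|)%N -> line_degree d g ->
  exists2 Q : {mpoly F[m]}, (msize Q <= d.+1)%N & forall a, g a = mpeval Q a.
Proof.
move=> ltq dg; apply: (@line_degree_mpoly_of_coords m) => // a b ab.
by congr g; apply/rowP => i; apply: ab.
Qed.

End LineDegree.

(** * Decoding along lines *)

(* [Lam b u] is the polynomial of the line [t |-> b + t u]; [u = 0] is allowed, so that
   directions are uniform over the whole space. *)
Definition line_family (F : finFieldType) (m d : nat)
    (Lam : 'rV[F]_m -> 'rV[F]_m -> {poly F}) : Prop :=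
  (forall b u, (size (Lam b u) <= d.+1)%N) /\
  (forall b u s t, (Lam (b + s *: u) u).[t] = (Lam b u).[t + s]).

Section LineDecoding.
Variables (R : realFieldType) (F : finFieldType) (m d : nat) (f : 'rV[F]_m -> F).
Implicit Types (b u : 'rV[F]_m) (p : {poly F}) (Lam : 'rV[F]_m -> 'rV[F]_m -> {poly F}).

Definition line_dist b u p : R := \mean_t (f (b + t *: u) != p.[t])%:R.

Definition family_err Lam : R := \mean_b \mean_u (f b != (Lam b u).[0])%:R.

Definition unique_radius : R := (1 - d%:R / #|F|%:R) / 2.

Definition decodes Lam : Prop :=
  forall b u p, (size p <= d.+1)%N -> line_dist b u p < unique_radius -> Lam b u = p.

Lemma family_err_ge0 Lam : 0 <= family_err Lam.
Proof. by apply: mean_ge0 => b; apply: mean_indicator_ge0. Qed.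

Lemma line_dist_distinct b u p p' :
  (size p <= d.+1)%N -> (size p' <= d.+1)%N -> p != p' ->
  2 * unique_radius <= line_dist b u p + line_dist b u p'.
Proof.
move=> sp sp' pp'; rewrite /unique_radius mulrC divfK ?pnatr_eq0 //.
apply: le_trans (mean_poly_neq R sp sp' pp') _; rewrite -meanD; apply: ler_mean => t.
by apply: le_trans (ler_neq_triangle _ _ (f (b + t *: u)) _) _; rewrite eq_sym.
Qed.

Lemma line_dist_shift b u s p :
  line_dist (b + s *: u) u (p \Po ('X + s%:P)) = line_dist b u p.
Proof.
rewrite /line_dist -[RHS](reindex_mean _ (addIr s)); apply: eq_mean => t.
by rewrite horner_comp !hornerE scalerDl addrA addrAC.
Qed.

Lemma family_err_shift Lam t :
  line_family d Lam -> \mean_b \mean_u (f (b + t *: u) != (Lam b u).[t])%:R = family_err Lam.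
Proof.
case=> _ shift; rewrite /family_err exchange_mean [RHS]exchange_mean; apply: eq_mean => u.
rewrite -[RHS](reindex_mean _ (addIr (t *: u))); apply: eq_mean => b.
by rewrite shift add0r.
Qed.

Lemma family_err_line_dist Lam :
  line_family d Lam -> \mean_b \mean_u line_dist b u (Lam b u) = family_err Lam.
Proof.
move=> fam; under eq_mean do rewrite exchange_mean.
rewrite exchange_mean -[RHS](mean_const _ (card_zmod_gt0 F)).
by apply: eq_mean => t; apply: family_err_shift.
Qed.

Definition decode Lam b u : {poly F} :=
  if [pick v : 'rV[F]_d.+1 | line_dist b u (rVpoly v) < unique_radius] is Some v
  then rVpoly v else Lam b u.

Lemma decode_near Lam b u p :
  (size p <= d.+1)%N -> line_dist b u p < unique_radius -> decode Lam b u = p.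
Proof.
move=> sp near; rewrite /decode; case: pickP => [v near_v|none]; last first.
  by have := none (poly_rV p); rewrite poly_rV_K // near.
apply: contraTeq near_v => vp; rewrite -leNgt.
have := line_dist_distinct b u (size_poly _ _) sp vp; move: near; lra.
Qed.

Lemma decodeP Lam b u :
  line_dist b u (decode Lam b u) < unique_radius /\ (size (decode Lam b u) <= d.+1)%N \/
  decode Lam b u = Lam b u /\
  forall p, (size p <= d.+1)%N -> unique_radius <= line_dist b u p.
Proof.
rewrite /decode; case: pickP => [v near_v|none]; [left; split=> //|right; split=> // p sp].
  exact: size_poly.
by rewrite leNgt; have := none (poly_rV p); rewrite poly_rV_K // => ->.
Qed.

Lemma size_comp_shift p s : (size p <= d.+1)%N -> (size (p \Po ('X + s%:P))%R <= d.+1)%N.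
Proof. by rewrite size_comp_poly2 // size_XaddC. Qed.

Lemma decode_line_family Lam : line_family d Lam -> line_family d (decode Lam).
Proof.
case=> szLam shift; split=> [b u|b u s t].
  by case: (decodeP Lam b u) => [[_ //]|[-> _]].
have [[near sdec]|[-> far]] := decodeP Lam b u.
  have /(decode_near Lam) -> :
      line_dist (b + s *: u) u (decode Lam b u \Po ('X + s%:P)) < unique_radius.
  - by rewrite line_dist_shift.
  - by rewrite horner_comp !hornerE.
  - exact: size_comp_shift.
have [[near sdec]|[-> _]] := decodeP Lam (b + s *: u) u; last exact: shift.
have := far _ (size_comp_shift (- s) sdec).
by rewrite -[b in line_dist b](addrK (s *: u)) -scaleNr line_dist_shift leNgt near.
Qed.

Lemma family_err_decode Lam : line_family d Lam -> family_err (decode Lam) <= family_err Lam.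
Proof.
move=> fam; have [szLam _] := fam; have [szdec _] := decode_line_family fam.
rewrite -!family_err_line_dist //; last exact: decode_line_family.
apply: ler_mean => b; apply: ler_mean => u.
have [[near _]|[-> _]//] := decodeP Lam b u.
have [->//|ne] := eqVneq (decode Lam b u) (Lam b u).
by have := line_dist_distinct b u (szdec b u) (szLam b u) ne; move: near; lra.
Qed.

End LineDecoding.

(** * Bilinear surfaces *)

(* The row [i] of the surface [x + i h1 + j h2 + i j h3], as a polynomial in [j]; exchanging
   [h1] and [h2] gives the columns. *)
Definition surface_row (F : finFieldType) (m : nat) (Lam : 'rV[F]_m -> 'rV[F]_m -> {poly F})
    (x h1 h2 h3 : 'rV[F]_m) (i : F) : {poly F} :=
  Lam (x + i *: h1) (h2 + i *: h3).

Lemma surface_point (F : finFieldType) (m : nat) (x h1 h2 h3 : 'rV[F]_m) (i j : F) :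
  x + i *: h1 + j *: (h2 + i *: h3) = x + j *: h2 + i *: (h1 + j *: h3).
Proof. by rewrite !scalerDr !scalerA [j * i]mulrC !addrA [x + _ + _]addrAC. Qed.

Section Surface.
Variables (R : realFieldType) (F : finFieldType) (m d : nat) (f : 'rV[F]_m -> F).
Variable Lam : 'rV[F]_m -> 'rV[F]_m -> {poly F}.
Hypotheses (fam : line_family d Lam) (dec : decodes R d f Lam).
Hypotheses (d_gt0 : (0 < d)%N) (ltq : (1000 * d < #|F|)%N).
Implicit Types (x h k : 'rV[F]_m) (i j : F).

Local Notation V := 'rV[F]_m.
Local Notation row := (surface_row Lam).
Local Notation dist := (line_dist R f).
Local Notation err := (family_err R f Lam).
(* The row and the column of parameter [0] pass through the fixed point [x], so that nothing is
   known about their error: they account for [#|F|^-1]. *)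
Local Notation noise := (err + #|F|%:R^-1).

Let size_row x h1 h2 h3 i : (size (row x h1 h2 h3 i) <= d.+1)%N.
Proof. by have [szLam _] := fam; apply: szLam. Qed.

Let noise_ge0 : 0 <= noise.
Proof. by rewrite addr_ge0 ?family_err_ge0 ?invr_ge0 ?ler0n. Qed.

Let dq_small : d%:R / #|F|%:R <= 1000^-1 :> R.
Proof. exact: (degree_ratio_le R _ ltq). Qed.

Let q_large : #|F|%:R^-1 <= 1000^-1 :> R.
Proof. exact: (inv_card_le R _ d_gt0 ltq). Qed.

Lemma mean_surface_row_neq x h2 i t :
  i != 0 ->
  \mean_h1 \mean_h3 (f (x + i *: h1 + t *: (h2 + i *: h3)) != (row x h1 h2 h3 i).[t])%:R = err.
Proof.
move=> i0; rewrite -(family_err_shift R f t fam).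
rewrite -(mean_affine x (fun b => \mean_u (f (b + t *: u) != (Lam b u).[t])%:R) i0).
apply: eq_mean => h1.
exact: (mean_affine h2 (fun u => (f (x + i *: h1 + t *: u) != (Lam (x + i *: h1) u).[t])%:R) i0).
Qed.

(* The error of the column polynomials along the row [i]. *)
Definition cross_err x h1 h2 h3 i : R :=
  \mean_j (f (x + i *: h1 + j *: (h2 + i *: h3)) != (row x h2 h1 h3 j).[i])%:R.

Lemma mean_cross_err x h1 i : \mean_h2 \mean_h3 cross_err x h1 h2 h3 i <= noise.
Proof.
rewrite /cross_err; under eq_mean do rewrite exchange_mean.
rewrite exchange_mean; apply: (mean_le_except (t0 := 0)) => [||j j0]; first exact: family_err_ge0.
  by apply: mean_le => // h2; apply: mean_indicator_le1.
rewrite le_eqVlt -(mean_surface_row_neq x h1 i j0); apply/orP; left; apply/eqP.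
by apply: eq_mean => h2; apply: eq_mean => h3; rewrite surface_point.
Qed.

Lemma mean_triple_cross_err x i :
  \mean_(h : V * V * V) cross_err x h.1.1 h.1.2 h.2 i <= noise.
Proof.
apply: (mean_triple_le1 (phi := fun h1 h2 h3 => cross_err x h1 h2 h3 i)) => // h1.
exact: mean_cross_err.
Qed.

Lemma mean_triple_cross_errC x i :
  \mean_(h : V * V * V) cross_err x h.1.2 h.1.1 h.2 i <= noise.
Proof.
apply: (mean_triple_le2 (phi := fun h1 h2 h3 => cross_err x h2 h1 h3 i)) => // h2.
exact: mean_cross_err.
Qed.

Definition surface_disagreement x h1 h2 h3 : R :=
  grid_disagreement R (row x h1 h2 h3) (row x h2 h1 h3).

Lemma surface_disagreement_ge0 x h1 h2 h3 : 0 <= surface_disagreement x h1 h2 h3.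
Proof. by apply: mean_ge0 => i; apply: mean_indicator_ge0. Qed.

Lemma surface_disagreement_le x h1 h2 h3 :
  surface_disagreement x h1 h2 h3 <=
    \mean_i (dist (x + i *: h1) (h2 + i *: h3) (row x h1 h2 h3 i) + cross_err x h1 h2 h3 i).
Proof.
apply: ler_mean => i; rewrite -meanD; apply: ler_mean => j.
apply: le_trans (ler_neq_triangle _ _ (f (x + i *: h1 + j *: (h2 + i *: h3))) _) _.
by rewrite eq_sym.
Qed.

(* For [q > 1000 d], [12/25] is below the unique decoding radius [(1 - d/q) / 2], and half of it
   is below the threshold [(1/2 - d/q)^2] of the bivariate test. *)
Lemma row_decoded (Q : {poly {poly F}}) (B : F -> {poly F}) x k i :
  (sizeY Q <= d.+1)%N ->
  let err_Q := \mean_j ((swapXY Q).[j%:P] != B j)%:R + \mean_j (f (x + j *: k) != (B j).[i])%:R in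
  err_Q < 12 / 25 -> Lam x k = Q.[i%:P] /\ dist x k (Lam x k) <= err_Q.
Proof.
move=> sYQ err_Q small.
have le_err : dist x k Q.[i%:P] <= err_Q.
  rewrite /err_Q addrC -meanD; apply: ler_mean => j.
  apply: le_trans (ler_neq_triangle _ _ (B j).[i] _) _; rewrite lerD2l -horner2_swapXY eq_sym.
  exact: (ler_neq_app R (horner^~ i)).
have LamQ : Lam x k = Q.[i%:P].
  apply: dec; first by rewrite (leq_trans (max_size_evalC _ _)).
  by apply: le_lt_trans le_err _; rewrite /unique_radius; move: small dq_small; lra.
by rewrite LamQ.
Qed.

Lemma surface_decoded x h1 h2 h3 :
  surface_disagreement x h1 h2 h3 < 6 / 25 ->
  let dis := surface_disagreement x h1 h2 h3 in
  exists Q : {poly {poly F}}, [/\ (size Q <= d.+1)%N,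
    \mean_i (Q.[i%:P] != row x h1 h2 h3 i)%:R <= 2 * dis,
    forall i, 2 * dis + cross_err x h1 h2 h3 i < 12 / 25 ->
      row x h1 h2 h3 i = Q.[i%:P] /\
      dist (x + i *: h1) (h2 + i *: h3) (row x h1 h2 h3 i) <= 2 * dis + cross_err x h1 h2 h3 i &
    forall j, 2 * dis + cross_err x h2 h1 h3 j < 12 / 25 -> row x h2 h1 h3 j = (swapXY Q).[j%:P]].
Proof.
move=> small dis.
have [||||Q [sQ sYQ Qrow Qcol]] :=
  @bivariate_low_degree_test R F (row x h1 h2 h3) (row x h2 h1 h3) d.
- by move=> i; apply: size_row.
- by move=> j; apply: size_row.
- by move: ltq; lia.
- by apply: lt_le_trans small _; move: dq_small; nra.
exists Q; split=> // [i lt|j lt].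
  have [|rowQ le] :=
      @row_decoded Q (row x h2 h1 h3) (x + i *: h1) (h2 + i *: h3) i sYQ.
    by apply: le_lt_trans lt; rewrite lerD2r.
  by split; rewrite // (le_trans le) // lerD2r.
have := @row_decoded (swapXY Q) (row x h1 h2 h3) (x + j *: h2) (h1 + j *: h3) j.
rewrite sizeY_swapXY swapXYK => /(_ sQ) []//.
by apply: le_lt_trans lt; rewrite lerD2r.
Qed.

Lemma surface_row0 x h1 h2 h3 : row x h1 h2 h3 0 = Lam x h2.
Proof. by rewrite /surface_row !scale0r !addr0. Qed.

Lemma mean_surface_row_dist x h1 h2 h3 :
  \mean_i dist (x + i *: h1) (h2 + i *: h3) (row x h1 h2 h3 i) = \mean_j cross_err x h2 h1 h3 j.
Proof.
rewrite [LHS]exchange_mean; apply: eq_mean => j; apply: eq_mean => i.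
by rewrite surface_point.
Qed.

Lemma mean_surface_disagreement x :
  \mean_(h : V * V * V) surface_disagreement x h.1.1 h.1.2 h.2 <= 2 * noise.
Proof.
apply: le_trans (_ : \mean_(h : V * V * V) (\mean_j cross_err x h.1.2 h.1.1 h.2 j +
                                           \mean_i cross_err x h.1.1 h.1.2 h.2 i) <= _).
  by apply: ler_mean => h; rewrite -mean_surface_row_dist -meanD; apply: surface_disagreement_le.
rewrite meanD mulrDl mul1r lerD // mean_exchange_le // => i.
  exact: mean_triple_cross_errC.
exact: mean_triple_cross_err.
Qed.

Lemma line_dist_surface x h1 h2 h3 :
  dist x h2 (Lam x h2) <= 25 / 12 * (2 * surface_disagreement x h1 h2 h3 + cross_err x h1 h2 h3 0).
Proof.
have dis0 := surface_disagreement_ge0 x h1 h2 h3.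
have cross0 : 0 <= cross_err x h1 h2 h3 0 by apply: mean_indicator_ge0.
case: (ltrP (2 * surface_disagreement x h1 h2 h3 + cross_err x h1 h2 h3 0) (12 / 25)) => [lt|ge].
  have [|Q [_ _ decoded _]] := @surface_decoded x h1 h2 h3; first by move: lt; lra.
  have [_] := decoded 0 lt; rewrite surface_row0 !scale0r !addr0; move: dis0 cross0; lra.
have dist1 : dist x h2 (Lam x h2) <= 1 by apply: mean_indicator_le1.
by move: ge; lra.
Qed.

Lemma mean_line_dist x : \mean_k dist x k (Lam x k) <= 125 / 12 * noise.
Proof.
have V0 := card_zmod_gt0 V.
have -> : \mean_k dist x k (Lam x k) = \mean_(h : V * V * V) dist x h.1.2 (Lam x h.1.2).
  rewrite !mean_pair /= mean_const //; apply: eq_mean => k; by rewrite mean_const.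
apply: le_trans (_ : _ <= \mean_(h : V * V * V) (25 / 12 *
    (2 * surface_disagreement x h.1.1 h.1.2 h.2 + cross_err x h.1.1 h.1.2 h.2 0))) _.
  by apply: ler_mean => h; apply: line_dist_surface.
rewrite meanZ meanD meanZ.
by have := mean_surface_disagreement x; have := mean_triple_cross_err x 0; lra.
Qed.

Lemma center_neq_surface x h1 h2 h3 :
  ((Lam x h1).[0] != (Lam x h2).[0])%:R <=
    25 / 12 * (2 * surface_disagreement x h1 h2 h3 +
                 (cross_err x h1 h2 h3 0 + cross_err x h2 h1 h3 0)).
Proof.
have dis0 := surface_disagreement_ge0 x h1 h2 h3.
have cross0 k l : 0 <= cross_err x k l h3 0 by apply: mean_indicator_ge0.
have := cross0 h1 h2; have := cross0 h2 h1.
set total := 2 * _ + _; case: (ltrP total (12 / 25)) => [lt|ge] c21 c12.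
  rewrite /total in lt *.
  have [|Q [_ _ decoded_row decoded_col]] := @surface_decoded x h1 h2 h3; first by move: lt; lra.
  have [|row_h2 _] := decoded_row 0; first by move: lt; lra.
  have col_h1 : row x h2 h1 h3 0 = (swapXY Q).[0%:P] by apply: decoded_col; move: lt; lra.
  rewrite !surface_row0 in row_h2 col_h1.
  by rewrite row_h2 col_h1 horner2_swapXY eqxx /=; lra.
by apply: le_trans (_ : 1 <= _); [case: (_ != _) | move: ge; lra].
Qed.

Lemma mean_center_neq x :
  \mean_h1 \mean_h2 ((Lam x h1).[0] != (Lam x h2).[0])%:R <= 25 / 2 * noise.
Proof.
have V0 := card_zmod_gt0 V.
have -> : \mean_h1 \mean_h2 ((Lam x h1).[0] != (Lam x h2).[0])%:R =
    \mean_(h : V * V * V) ((Lam x h.1.1).[0] != (Lam x h.1.2).[0])%:R :> R.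
  by rewrite !mean_pair /=; do 2!apply: eq_mean => ?; rewrite mean_const.
apply: le_trans (_ : _ <= \mean_(h : V * V * V) (25 / 12 *
    (2 * surface_disagreement x h.1.1 h.1.2 h.2 +
       (cross_err x h.1.1 h.1.2 h.2 0 + cross_err x h.1.2 h.1.1 h.2 0)))) _.
  by apply: ler_mean => h; apply: center_neq_surface.
rewrite meanZ meanD meanZ meanD.
have := mean_surface_disagreement x; have := mean_triple_cross_err x 0.
by have := mean_triple_cross_errC x 0; lra.
Qed.

Lemma center_exists x : exists c, \mean_h ((Lam x h).[0] != c)%:R <= 25 / 2 * noise.
Proof.
have [h1 le] := exists_le_mean
  (fun h1 => \mean_h2 ((Lam x h1).[0] != (Lam x h2).[0])%:R : R) (card_zmod_gt0 V).
exists (Lam x h1).[0]; apply: le_trans (le_trans le (mean_center_neq x)).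
by apply: ler_mean => h2; rewrite eq_sym.
Qed.

Section Center.
Variable g : V -> F.
Hypothesis err_small : err <= 1 / 100.
Hypothesis centerP : forall x, \mean_h ((Lam x h).[0] != g x)%:R <= 25 / 2 * noise.

Lemma mean_surface_row_center x h i :
  \mean_(k : V * V) ((row x h k.1 k.2 i).[0] != g (x + i *: h))%:R <= 25 / 2 * noise.
Proof.
rewrite mean_pair /=; apply: mean_exchange_le => [|h2]; first by move: noise_ge0; lra.
by have := centerP (x + i *: h); rewrite -(reindex_mean _ (addIr (i *: h2))).
Qed.

Lemma mean_surface_disagreement_along x h :
  \mean_(k : V * V) surface_disagreement x h k.1 k.2 <= 137 / 12 * noise.
Proof.
apply: le_trans (_ : \mean_(k : V * V) \mean_i (dist (x + i *: h) (k.1 + i *: k.2)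
  (row x h k.1 k.2 i) + cross_err x h k.1 k.2 i) <= _).
  by apply: ler_mean => k; apply: surface_disagreement_le.
apply: mean_exchange_le => [|i]; first by move: noise_ge0; lra.
rewrite meanD !mean_pair /=; have := mean_cross_err x h i.
suff : \mean_h1 \mean_h2 dist (x + i *: h) (h1 + i *: h2) (row x h h1 h2 i) <= 125 / 12 * noise.
  by lra.
apply: mean_exchange_le => [|h2]; first by move: noise_ge0; lra.
by have := mean_line_dist (x + i *: h); rewrite -(reindex_mean _ (addIr (i *: h2))).
Qed.

Lemma exists_good_surface x h i0 :
  exists h1 h2, (row x h h1 h2 i0).[0] = g (x + i0 *: h) /\
    2 * surface_disagreement x h h1 h2 + \mean_i ((row x h h1 h2 i).[0] != g (x + i *: h))%:R
      + cross_err x h h1 h2 i0 < 12 / 25.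
Proof.
pose total (k : V * V) : R := ((row x h k.1 k.2 i0).[0] != g (x + i0 *: h))%:R + 25 / 12 *
  (2 * surface_disagreement x h k.1 k.2 + \mean_i ((row x h k.1 k.2 i).[0] != g (x + i *: h))%:R
    + cross_err x h k.1 k.2 i0).
have [[h1 h2] /= le_total] : exists k : V * V, total k <= mean total.
  by apply: exists_le_mean; rewrite card_prod muln_gt0 card_zmod_gt0.
have mean_total : mean total < 1.
  have centers : \mean_(k : V * V) \mean_i ((row x h k.1 k.2 i).[0] != g (x + i *: h))%:R
      <= 25 / 2 * noise.
    by apply: mean_exchange_le => [|i]; [move: noise_ge0; lra | apply: mean_surface_row_center].
  have cross : \mean_(k : V * V) cross_err x h k.1 k.2 i0 <= noise.
    by rewrite mean_pair; apply: mean_cross_err.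
  (* The average is at most [(25/2 + 25/12 (137/6 + 25/2 + 1)) noise], where [noise <= 11/1000]. *)
  rewrite /total meanD meanZ !meanD meanZ.
  have center_i0 := mean_surface_row_center x h i0.
  have disagreement := mean_surface_disagreement_along x h.
  by move: centers cross center_i0 disagreement err_small q_large; lra.
exists h1, h2; have := le_lt_trans le_total mean_total; rewrite /total /=.
have := surface_disagreement_ge0 x h h1 h2.
have : 0 <= cross_err x h h1 h2 i0 by apply: mean_indicator_ge0.
have := @mean_indicator_ge0 R F (fun i => (row x h h1 h2 i).[0] != g (x + i *: h)).
have [eq_center|_] := eqVneq (row x h h1 h2 i0).[0] (g (x + i0 *: h)); last by rewrite /=; lra.
by rewrite /= => *; split=> //; lra.
Qed.

Lemma center_near_line x h i0 :
  exists p : {poly F}, [/\ (size p <= d.+1)%N, g (x + i0 *: h) = p.[i0] &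
    line_dist R g x h p < unique_radius R F d].
Proof.
have [h1 [h2 [<- small]]] := exists_good_surface x h i0.
have dis0 := surface_disagreement_ge0 x h h1 h2.
have cross0 : 0 <= cross_err x h h1 h2 i0 by apply: mean_indicator_ge0.
have := @mean_indicator_ge0 R F (fun i => (row x h h1 h2 i).[0] != g (x + i *: h)).
set centers := \mean_i _ in small * => centers0.
have [|Q [sQ row_Q decoded _]] := @surface_decoded x h h1 h2; first by move: small; lra.
have [|row_i0 _] := decoded i0; first by move: small; lra.
exists (swapXY Q).[0%:P]; split.
- by rewrite (leq_trans (max_size_evalC _ _)) // sizeY_swapXY.
- by rewrite horner2_swapXY row_i0.
have : line_dist R g x h (swapXY Q).[0%:P] <= centers + \mean_i (Q.[i%:P] != row x h h1 h2 i)%:R.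
  rewrite addrC -meanD; apply: ler_mean => i; rewrite horner2_swapXY eq_sym.
  apply: le_trans (ler_neq_triangle _ _ (row x h h1 h2 i).[0] _) _; rewrite lerD2r.
  exact: (ler_neq_app R (horner^~ 0)).
by rewrite /unique_radius; move: small row_Q dq_small; lra.
Qed.

Lemma center_line_degree : line_degree d g.
Proof.
move=> x h; have [p [sp _ near_p]] := center_near_line x h 0; exists p => // t.
have [p' [sp' -> near_p']] := center_near_line x h t.
suff -> : p' = p by [].
apply: contraTeq near_p' => ne; rewrite -leNgt.
by have := line_dist_distinct R g x h sp' sp ne; move: near_p; lra.
Qed.

End Center.

End Surface.

(** * The low-degree test for line families *)

Section LineFamilyTest.
Variables (R : realFieldType) (F : finFieldType) (m : nat) (f : 'rV[F]_m -> F).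
Implicit Type Lam : 'rV[F]_m -> 'rV[F]_m -> {poly F}.

Lemma point_errE (Q : {mpoly F[m]}) : point_err R f Q = \mean_a (f a != mpeval Q a)%:R.
Proof. by rewrite mean_indicator. Qed.

Lemma mean_neq_center (g : 'rV[F]_m -> F) Lam c :
  (forall x, \mean_h ((Lam x h).[0] != g x)%:R <= c) ->
  (1 - c) * \mean_x (f x != g x)%:R <= family_err R f Lam.
Proof.
move=> centerP; rewrite -meanZ; apply: ler_mean => x.
have [_|fg] := eqVneq (f x) (g x); first by rewrite mulr0 mean_ge0 // => u; apply: ler0n.
rewrite mulr1 lerBlDr -[leLHS](mean_const 1 (card_zmod_gt0 'rV[F]_m)).
apply: le_trans (lerD (lexx _) (centerP x)); rewrite -meanD; apply: ler_mean => u.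
by apply: le_trans (ler_neq_triangle _ _ (Lam x u).[0] _); rewrite fg.
Qed.

Lemma line_family_constant Lam :
  line_family 0 Lam -> exists c, \mean_a (f a != c)%:R <= 2 * family_err R f Lam.
Proof.
move=> fam; have [szLam _] := fam.
have [a le_a] := exists_le_mean (fun a => \mean_u (f a != f (a + u))%:R : R)
  (card_zmod_gt0 'rV[F]_m).
exists (f a); rewrite -(reindex_mean _ (addrI a)).
under eq_mean do rewrite eq_sym; apply: le_trans le_a _.
rewrite mulrDl mul1r -{1}(family_err_shift R f 0 fam) -(family_err_shift R f 1 fam) -meanD.
apply: ler_mean => b; rewrite -meanD; apply: ler_mean => u.
rewrite (size1_polyC (szLam b u)) !hornerC scale0r addr0 scale1r [X in _ <= _ + (~~ X)%:R]eq_sym.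
exact: ler_neq_triangle.
Qed.

Lemma line_family_polynomial d Lam :
  (0 < d)%N -> (1000 * d < #|F|)%N -> line_family d Lam -> family_err R f Lam <= 1 / 100 ->
  exists Q : {mpoly F[m]}, (msize Q <= d.+1)%N /\ point_err R f Q <= 4 * family_err R f Lam.
Proof.
move=> d_gt0 ltq fam small.
have err_dec := family_err_decode R f fam; have err0 := family_err_ge0 R f (decode R d f Lam).
have small_dec := le_trans err_dec small.
have fam_dec := decode_line_family R f fam.
have dec : decodes R d f (decode R d f Lam) by move=> b u p; apply: decode_near.
have [g centerP] := fin_all_exists (center_exists fam_dec dec d_gt0 ltq).
have dg := center_line_degree fam_dec dec d_gt0 ltq small_dec centerP.
have [|Q sQ gQ] := line_degree_mpoly _ dg; first by move: ltq; lia.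
exists Q; split=> //; rewrite point_errE; under eq_mean do rewrite -gQ.
have q_large := inv_card_le R (isT : 0 < 1000)%N d_gt0 ltq.
have := mean_neq_center centerP.
by move: small_dec q_large err_dec err0 (mean_ge0 (fun x => ler0n R (f x != g x))); nra.
Qed.

End LineFamilyTest.

(** * From a lines oracle to a line family *)

Section LinesOracle.
Variables (F : finFieldType) (m : nat).
Implicit Types (a b u v : 'rV[F]_m) (L : {set 'rV[F]_m}).

Lemma line_shift b u s : line (b + s *: u) u = line b u.
Proof.
apply/setP => z; apply/imsetP/imsetP => [] [t _ ->].
  by exists (s + t); rewrite // scalerDl addrA.
by exists (t - s); rewrite // scalerBl -addrA [s *: u + _]addrC subrK.
Qed.

Lemma line_scale b u c : c != 0 -> line b (c *: u) = line b u.
Proof.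
move=> c0; apply/setP => z; apply/imsetP/imsetP => [] [t _ ->].
  by exists (t * c); rewrite // scalerA.
by exists (t / c); rewrite // scalerA divfK.
Qed.

Lemma mem_line_base b u : b \in line b u.
Proof. by apply/imsetP; exists 0; rewrite // scale0r addr0. Qed.

Lemma line_eq_base a b v : b \in line a v -> line a v = line b v.
Proof. by case/imsetP => s _ ->; rewrite line_shift. Qed.

Lemma line_eq_scale b u v : line b u = line b v -> exists c, u = c *: v.
Proof.
move=> e; have : b + u \in line b u by apply/imsetP; exists 1; rewrite // scale1r.
by rewrite e => /imsetP[c _ /addrI->]; exists c.
Qed.

Lemma is_line_line b u : u != 0 -> is_line (line b u).
Proof. by move=> u0; apply/existsP; exists b; apply/existsP; exists u; rewrite u0 eqxx. Qed.

Lemma lines_throughP b L :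
  reflect (exists2 v, v != 0 & L = line b v) (L \in lines_through b).
Proof.
rewrite inE; apply: (iffP andP) => [[/existsP[a /existsP[v /andP[v0 /eqP->]]] bL]|[v v0 ->]].
  by exists v; rewrite // (line_eq_base bL).
by rewrite is_line_line ?mem_line_base.
Qed.

Lemma card_line_directions b v :
  v != 0 -> #|[set u | (u != 0) && (line b u == line b v)]| = #|F|.-1.
Proof.
move=> v0; rewrite -(cardsC1 (0 : F)).
rewrite -(card_imset _ (f := fun c => c *: v)) => [|c c' /eqP]; last first.
  by rewrite -subr_eq0 -scalerBl scaler_eq0 (negPf v0) orbF subr_eq0 => /eqP.
apply: eq_card => u; rewrite inE; apply/andP/imsetP => [[u0 /eqP/line_eq_scale[c uc]]|[c c0 ->]].
  by exists c; rewrite // !inE; apply: contraNneq u0 => c0; rewrite uc c0 scale0r.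
by move: c0; rewrite !inE => c0; rewrite line_scale // scaler_eq0 negb_or c0 v0.
Qed.

Lemma card_directions b (X : pred {set 'rV[F]_m}) :
  #|[set u | (u != 0) && X (line b u)]| = (#|F|.-1 * #|[set L in lines_through b | X L]|)%N.
Proof.
rewrite -sum1_card (partition_big (line b) (mem [set L in lines_through b | X L])) /=.
  rewrite mulnC -sum_nat_const; apply: eq_bigr => L.
  rewrite inE => /andP[/lines_throughP[v v0 ->] XL].
  rewrite -(card_line_directions b v0) sum1_card -[RHS]cardsE; apply: eq_card => u.
  rewrite !inE unfold_in /= !inE -andbA.
  by have [->|] := eqVneq (line b u) (line b v); rewrite ?XL ?andbF.
move=> u; rewrite inE => /andP[u0 Xu]; rewrite inE Xu andbT.
by apply/lines_throughP; exists u.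
Qed.

Lemma size_comp_affine (p : {poly F}) c s n :
  (size p <= n.+1)%N -> (size (p \Po (c *: 'X + s%:P))%R <= n.+1)%N.
Proof.
move=> sp; apply: leq_trans (size_comp_poly_leq _ _) _; rewrite ltnS.
have [deg_p deg_q] : ((size p).-1 <= n)%N /\ ((size (c *: 'X + s%:P)%R).-1 <= 1)%N.
  split; first by case: (size p) sp.
  rewrite -subn1 leq_subLR (leq_trans (size_polyD _ _)) // geq_max.
  by rewrite (leq_trans (size_scale_leq _ _)) ?size_polyX ?(leq_trans (size_polyC_leq1 _)).
by rewrite (leq_trans (leq_mul deg_p deg_q)) ?muln1.
Qed.

Lemma lines_oracle_poly d (P : {set 'rV[F]_m} -> 'rV[F]_m -> F) b u :
  lines_oracle d P -> u != 0 ->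
  exists2 p : {poly F}, (size p <= d.+1)%N & forall t, p.[t] = P (line b u) (b + t *: u).
Proof.
move=> orc u0; have [a [v [p [_ eqL sp pE]]]] := orc _ (is_line_line b u0).
have bL : b \in line a v by rewrite -eqL mem_line_base.
have [c uE] : exists c, u = c *: v.
  by apply: (line_eq_scale (b := b)); rewrite eqL (line_eq_base bL).
case/imsetP: bL => s _ bE; exists (p \Po (c *: 'X + s%:P)); first exact: size_comp_affine.
move=> t; rewrite horner_comp !hornerE -pE; congr P.
by rewrite {1}bE uE scalerDl scalerA [c * t]mulrC -addrA [s *: v + _]addrC.
Qed.

(* In the direction [u = 0] the constant [f b] makes no error. *)
Lemma lines_oracle_family d (f : 'rV[F]_m -> F) (P : {set 'rV[F]_m} -> 'rV[F]_m -> F) :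
  lines_oracle d P ->
  exists2 Lam, line_family d Lam &
    forall b u, (f b != (Lam b u).[0]) = (u != 0) && (f b != P (line b u) b).
Proof.
move=> orc.
have /fin_all_exists2[Lam szLam LamE] (bu : 'rV[F]_m * 'rV[F]_m) :
  exists2 p : {poly F}, (size p <= d.+1)%N &
    forall t, p.[t] = if bu.2 == 0 then f bu.1 else P (line bu.1 bu.2) (bu.1 + t *: bu.2).
  have [_|u0] := eqVneq bu.2 0; last exact: lines_oracle_poly.
  by exists (f bu.1)%:P => [|t]; rewrite ?hornerC // (leq_trans (size_polyC_leq1 _)).
exists (fun b u => Lam (b, u)) => [|b u].
  split=> [b u|b u s t]; first exact: szLam.
  rewrite !LamE /=; have [->|_] := eqVneq u 0; first by rewrite scaler0 addr0.
  by rewrite line_shift [t + s]addrC scalerDl addrA.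
rewrite LamE /=; have [_|_] := eqVneq u 0; first by rewrite eqxx.
by rewrite scale0r addr0.
Qed.

Lemma lines_oracle_family_err (R : realFieldType) d (f : 'rV[F]_m -> F) P :
  lines_oracle d P ->
  exists2 Lam, line_family d Lam & family_err R f Lam <= line_point_err R f P.
Proof.
move=> orc; have [Lam fam LamE] := lines_oracle_family f orc; exists Lam => //.
rewrite /line_point_err mulrC; apply: ler_wpM2r; rewrite ?invr_ge0 ?ler0n //.
apply: ler_sum => b _; under eq_mean do rewrite LamE.
rewrite mean_indicator (card_directions b (fun L => f b != P L b)).
set bad := #|[set _ in _ | _]|; set K := #|lines_through b|.
have leN : (#|F|.-1 * K <= #|'rV[F]_m|)%N.
  have := card_directions b predT; rewrite (_ : [set L in _ | _] = lines_through b); last first.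
    by apply/setP => L; rewrite inE andbT.
  by move=> <-; apply: max_card.
have [K0|K0] := posnP K.
  have -> : bad = 0%N.
    by apply/eqP; rewrite -leqn0 -K0; apply/subset_leq_card/subsetP => L; rewrite inE => /andP[].
  by rewrite muln0 mul0r mulr0.
rewrite mulrC natrM mulrA; apply: ler_wpM2r; first exact: ler0n.
rewrite ler_pdivrMl ?ltr0n ?card_zmod_gt0 // ler_pdivlMr ?ltr0n // -natrM ler_nat.
exact: leN.
Qed.

End LinesOracle.

Theorem theorem1p2 :
  exists C : nat,
  forall (R : realFieldType) (F : finFieldType) (m d : nat),
    (0 < m)%N -> (C * d < #|F|)%N ->
  forall (f : 'rV[F]_m -> F) (P : {set 'rV[F]_m} -> 'rV[F]_m -> F) (delta : R),
    lines_oracle d P ->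
    0 < delta -> delta < 1 / 100 ->
    line_point_err R f P <= delta ->
  exists Q : {mpoly F[m]},
    (msize Q <= d.+1)%N /\ point_err R f Q <= 4 * delta.
Proof.
exists 1000%N => R F m d _ ltq f P delta orc delta0 delta_small le_delta.
have [Lam fam err_le] := lines_oracle_family_err R f orc.
have err_delta := le_trans err_le le_delta.
suff [Q [sQ errQ]] : exists Q : {mpoly F[m]},
    (msize Q <= d.+1)%N /\ point_err R f Q <= 4 * family_err R f Lam.
  by exists Q; split=> //; apply: le_trans errQ _; rewrite ler_pM2l.
have [d0|d_gt0] := posnP d; last first.
  by apply: line_family_polynomial fam _ => //; apply/ltW/(le_lt_trans err_delta).
rewrite d0 in fam *; have [c le_c] := line_family_constant R f fam.
exists c%:MP; split; first by rewrite mmeasureC; case: (_ != _).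
rewrite point_errE; under eq_mean do rewrite /mpeval mevalC.
by have := family_err_ge0 R f Lam; move: le_c; lra.
Qed.
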